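(* Let $m,n$ be positive integers with $3\le n\le m$. Then $\max\{\gamma(K): K\in\mathcal{P}(m,n)\}$ equals $(n-1)(m-1)+1$ when $m$ is even or when $m$ and $n$ are both odd, and it is at least $(n-1)(m-1)$ and at most $(n-1)(m-1)+1$ when $m$ is odd and $n$ is even.
   Context: A proper cone $K$ in $\mathbb{R}^n$ is a closed convex cone that is pointed ($K\cap(-K)=\{0\}$) and has nonempty interior. A polyhedral cone is a proper cone (in its linear span) with finitely many extreme rays; its dimension is the dimension of its linear span. $\mathcal{P}(m,n)$ denotes the set of all $n$-dimensional polyhedral cones with exactly $m$ extreme rays. $\pi(K)$ is the set of real $n\times n$ matrices $A$ with $AK\subseteq K$ (the $K$-nonnegative matrices). A matrix $A\in\pi(K)$ is $K$-primitive if there is a positive integer $p$ with $A^p(K\setminus\{0\})\subseteq \operatorname{int}K$; the smallest such $p$ is the exponent $\gamma(A)$ of $A$. For a polyhedral cone $K$, the set of exponents of $K$-primitive matrices is finite, and $\gamma(K)=\max\{\gamma(A): A \text{ is } K\text{-primitive}\}$. *)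

(* Defs.v *)
From HB Require Import structures.
From mathcomp Require Import all_boot all_order all_algebra.
From mathcomp Require Import all_classical all_reals all_analysis.

Set Implicit Arguments.
Unset Strict Implicit.
Unset Printing Implicit Defensive.

Import Order.TTheory GRing.Theory Num.Theory.
Import numFieldNormedType.Exports.

Local Open Scope classical_set_scope.
Local Open Scope card_scope.
Local Open Scope ring_scope.

Section Cones.
Variables (R : realType) (n : nat).
Implicit Types (K F : set 'cV[R]_n) (A : 'M[R]_n) (x y z : 'cV[R]_n).

Definition convex_cone K : Prop :=
  [/\ K !=set0,
      forall x y, K x -> K y -> K (x + y) &
      forall (c : R) x, 0 <= c -> K x -> K (c *: x)].

Definition pointed_cone K : Prop :=
  K `&` [set x | K (- x)] = [set 0].

Definition proper_cone K : Prop :=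
  [/\ closed K, convex_cone K, pointed_cone K & interior K !=set0].

Definition face K F : Prop :=
  [/\ F `<=` K, convex_cone F &
      forall x y, K x -> K y -> F (x + y) -> F x /\ F y].

Definition ray x : set 'cV[R]_n := [set c *: x | c in [set c : R | 0 <= c]].

Definition extreme_rays K : set (set 'cV[R]_n) :=
  [set F | face K F /\ exists2 x, x != 0 & F = ray x].

(* A belongs to pi(K). *)
Definition cone_nonneg K A : Prop := forall x, K x -> K (A *m x).

Definition power_positive K A (p : nat) : Prop :=
  forall x, K x -> x != 0 -> interior K ((A ^+ p) *m x).

Definition cone_primitive K A : Prop :=
  cone_nonneg K A /\ exists2 p : nat, (0 < p)%N & power_positive K A p.

(* gamma(A) = p. *)
Definition is_exponent K A (p : nat) : Prop :=
  [/\ (0 < p)%N, power_positive K A p &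
      forall q : nat, (0 < q)%N -> power_positive K A q -> (p <= q)%N].

(* gamma(K) = g. *)
Definition is_cone_exponent K (g : nat) : Prop :=
  (exists2 A, cone_primitive K A & is_exponent K A g) /\
  (forall A p, cone_primitive K A -> is_exponent K A p -> (p <= g)%N).

End Cones.

(* P(m, n), with each cone placed in its linear span R^n, so that it is proper
   there. *)
Definition polyhedral_cones (R : realType) (m n : nat) : set (set 'cV[R]_n) :=
  [set K | proper_cone K /\ extreme_rays K #= `I_m].

(* max {gamma(K) : K in P(m, n)} = N. As gamma is a relation here, the bound
   also asserts that gamma(K) is defined for every K in P(m, n): otherwise cones
   with unbounded exponents would be silently ignored. *)
Definition is_max_cone_exponent (R : realType) (m n N : nat) : Prop :=
  (exists2 K : set 'cV[R]_n,
     polyhedral_cones m K & is_cone_exponent K N) /\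
  (forall K : set 'cV[R]_n, polyhedral_cones m K ->
     exists2 g, is_cone_exponent K g & (g <= N)%N).

(* Main.v *)
(* Upper bound. Let x_1, ..., x_m span the extreme rays of K, let A be K-primitive
   and draw an arc i -> j when x_j lies in the face generated by A x_i. If
   A^s y >= e y with e > 0, the faces generated by y, A^s y, A^(2s) y, ... grow
   strictly until they fill K, so A^((n-1)s) y is interior. As A does not permute
   the extreme rays cyclically, from every vertex some walk of length a reaches a
   circuit of length s <= m - 1 with a + s <= m, and a + (n-1)s <= (n-1)(m-1) + 1.

   Lower bound. Let g be a monic divisor of degree n of f = X^m + E X^(m-1) - (1+E),
   E > 0, with g(1) = 0, and let K be the cone generated by 1, X, ..., X^(m-1) in
   R[X]/(g). Multiplication by X^-1 = (X^(m-1) + E X^(m-2))/(1+E) preserves K, and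
   X^-(m-1) = (X+E)/(1+E), so its power (n-1)(m-1) maps X^(m-1) to a multiple of
   (X+E)^(n-2). This is a boundary point if the coefficient of X^(n-1) is nonnegative
   on all generators. These coefficients are the complete homogeneous symmetric
   functions of the roots of g. When E tends to 0 the roots of f tend to the m-th roots
   of unity; if g takes those nearest to 1 (and -1 when n is even, whence m must be
   even) the limits are Gaussian binomials or alternating sums of these, and are
   positive. When m is odd and n is even, E tends to infinity instead: the roots but one
   tend to the (m-1)-th roots of unity, and the coefficient of X^0 gives a boundary point
   one step earlier. That K has exactly m extreme rays follows from the upper bound, since with
   fewer the exponent could not be that large. *)

Require Import Defs.
From mathcomp Require Import all_boot all_order all_algebra.
From mathcomp Require Import all_classical all_reals all_analysis.
From mathcomp Require Import complex.
From mathcomp Require Import lra ring zify.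

Set Implicit Arguments.
Unset Strict Implicit.
Unset Printing Implicit Defensive.

Import Order.TTheory GRing.Theory Num.Theory.
Import numFieldNormedType.Exports.

Local Open Scope classical_set_scope.
Local Open Scope card_scope.
Local Open Scope ring_scope.

(** * Cones and their faces *)

Section ConeOrder.
Variables (R : realType) (n : nat) (K : set 'cV[R]_n).
Implicit Types (A : 'M[R]_n) (x y z v : 'cV[R]_n) (a b : R).

(* For [y] in a cone [K], [absorbed x y] says that [x] lies in the face of [K]
   generated by [y], when [x] is in [K]. *)
Definition absorbed x y : Prop := exists2 e : R, 0 < e & K (y - e *: x).

Hypothesis Kcone : convex_cone K.

Lemma cone_add x y : K x -> K y -> K (x + y).
Proof. by case: Kcone => _ + _; apply. Qed.

Lemma cone_scale a x : 0 <= a -> K x -> K (a *: x).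
Proof. by case: Kcone => _ _; apply. Qed.

Lemma cone0 : K 0.
Proof. by case: Kcone => [[x Kx] _ _]; rewrite -(scale0r x); exact: cone_scale. Qed.

Lemma cone_sum (I : Type) (r : seq I) (P : pred I) (F : I -> 'cV[R]_n) :
  (forall i, P i -> K (F i)) -> K (\sum_(i <- r | P i) F i).
Proof. by move=> KF; elim/big_ind: _; [exact: cone0|exact: cone_add|]. Qed.

Lemma absorbed_refl x : K x -> absorbed x x.
Proof.
move=> Kx; exists 2^-1; first by rewrite invr_gt0.
rewrite -{1}(scale1r x) -scalerBl; apply: cone_scale => //; lra.
Qed.

Lemma absorbed_trans x y z : absorbed x y -> absorbed y z -> absorbed x z.
Proof.
move=> [e e0 Ke] [d d0 Kd]; exists (d * e); first exact: mulr_gt0.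
have -> : z - (d * e) *: x = (z - d *: y) + d *: (y - e *: x).
  by rewrite scalerBr scalerA addrA subrK.
by apply: cone_add => //; apply: cone_scale => //; exact: ltW.
Qed.

Lemma absorbed_addr x y z : absorbed x y -> K z -> absorbed x (y + z).
Proof.
by move=> [e e0 Ke] Kz; exists e => //; rewrite addrAC; exact: cone_add.
Qed.

Lemma absorbed_scaler a x y : 0 < a -> absorbed x y -> absorbed x (a *: y).
Proof.
move=> a0 [e e0 Ke]; exists (a * e); first exact: mulr_gt0.
by rewrite -scalerA -scalerBr; apply: cone_scale => //; exact: ltW.
Qed.

Lemma absorbed_scalel a x y : K y -> 0 <= a -> absorbed x y -> absorbed (a *: x) y.
Proof.
move=> Ky; rewrite le_eqVlt => /orP[/eqP <- _|a0 [e e0 Ke]].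
  by exists 1; rewrite ?scale0r ?scaler0 ?subr0.
exists (e / a); first exact: divr_gt0.
by rewrite scalerA divfK ?gt_eqF.
Qed.

Lemma absorbed_addl x x' y :
  K y -> absorbed x y -> absorbed x' y -> absorbed (x + x') y.
Proof.
move=> Ky [e e0 Ke] [d d0 Kd].
(* With weights [d / (e + d)] and [e / (e + d)], the convex combination of [y - e *: x] and
   [y - d *: x'] gives [x] and [x'] the same coefficient. *)
exists (e * d / (e + d)); first by rewrite divr_gt0 ?mulr_gt0 ?addr_gt0.
have ed : e + d != 0 by rewrite gt_eqF ?addr_gt0.
have -> : y - (e * d / (e + d)) *: (x + x') =
    (d / (e + d)) *: (y - e *: x) + (e / (e + d)) *: (y - d *: x').
  have -> : (e * d / (e + d)) = (d / (e + d)) * e by field.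
  rewrite !scalerBr !scalerA scalerDr addrACA -scalerDl -opprD.
  congr (_ - (_ + _)); last by congr (_ *: _); field.
  by rewrite (_ : d / (e + d) + e / (e + d) = 1) ?scale1r; last by field.
by apply: cone_add; apply: cone_scale => //; rewrite divr_ge0 ?addr_ge0 ?ltW.
Qed.

Lemma absorbed_sum (I : finType) (X : I -> 'cV[R]_n) (c : I -> R) i :
    (forall j, K (X j)) -> (forall j, 0 <= c j) -> c i != 0 ->
  absorbed (X i) (\sum_j c j *: X j).
Proof.
move=> KX c0 ci; rewrite (bigD1 i) //=; apply: absorbed_addr => //.
  by apply: absorbed_scaler; rewrite ?lt_def ?ci ?c0 //; exact: absorbed_refl.
by apply: cone_sum => // j _; exact: cone_scale.
Qed.

Lemma absorbed_mulmx A x y :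
  cone_nonneg K A -> absorbed x y -> absorbed (A *m x) (A *m y).
Proof.
by move=> KA [e e0 Ke]; exists e => //; rewrite scalemxAr -mulmxBr; exact: KA.
Qed.

Lemma cone_nonneg_pow A p : cone_nonneg K A -> cone_nonneg K (A ^+ p).
Proof.
move=> KA; elim: p => [|p IH] x Kx; first by rewrite expr0 mul1mx.
by rewrite exprS -mulmxE -mulmxA; exact/KA/IH.
Qed.

Lemma interior_absorbs y : interior K y -> forall v, absorbed v y.
Proof.
move=> Ky v.
have cf : (y - e *: v) @[e --> (0 : R)^'+] --> y - 0 *: v.
  apply: cvgB; first exact: cvg_cst.
  by apply: cvgZr_tmp; exact: cvg_at_right_filter.
rewrite scale0r subr0 in cf.
have [e [e0 Ke]] : exists e : R, 0 < e /\ K (y - e *: v).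
  apply: (@filter_ex _ ((0 : R)^'+)).
  by apply: filterI; [exact: nbhs_right_gt|exact: cf].
by exists e.
Qed.

Lemma interior_scale_add a x y :
  0 < a -> K y -> interior K x -> interior K (a *: x + y).
Proof.
move=> a0 Ky Kx.
have a1 : a != 0 by rewrite gt_eqF.
have cf : a^-1 *: (v - y) @[v --> a *: x + y] --> x.
  rewrite [X in _ --> X](_ : x = a^-1 *: ((a *: x + y) - y)); last first.
    by rewrite addrK scalerA mulVf ?scale1r.
  exact: (cvgZl_tmp (cvgB cvg_id (cvg_cst _))).
rewrite /interior /=; near=> v.
have Kv : K (a^-1 *: (v - y)) by near: v; exact: cf.
rewrite -(subrK y v); apply: cone_add => //.
by rewrite -(scale1r (v - y)) -(mulfV a1) -scalerA; apply: cone_scale => //; exact: ltW.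
Unshelve. all: by end_near. Qed.

Lemma absorbed_interior x y : interior K x -> absorbed x y -> interior K y.
Proof.
move=> Kx [e e0 Ke]; have -> : y = e *: x + (y - e *: x) by rewrite addrC subrK.
exact: interior_scale_add.
Qed.
End ConeOrder.

(** Among the subspaces contained in [P], one of maximal dimension contains every vector satisfying
    [P], since adjoining such a vector stays inside [P]. *)
Lemma exists_vspace (F : fieldType) (vT : vectType F) (P : vT -> Prop) :
    P 0 -> (forall u v, P u -> P v -> P (u + v)) ->
    (forall a v, P v -> P (a *: v)) ->
  exists U : {vspace vT}, forall v, v \in U <-> P v.
Proof.
move=> P0 Padd Pscale.
pose Q d := `[< exists2 U : {vspace vT}, (forall v, v \in U -> P v) & \dim U = d >].
have exQ : exists d, Q d.
  exists 0%N; apply/asboolP; exists 0%VS; last by rewrite dimv0.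
  by move=> v; rewrite memv0 => /eqP ->.
have ubQ d : Q d -> (d <= \dim (fullv : {vspace vT}))%N.
  by move=> /asboolP[U _ <-]; rewrite dimvS ?subvf.
case: (ex_maxnP exQ ubQ) => d /asboolP[U PU dU] maxd.
exists U => v; split=> [/PU//|Pv].
have Q' : Q (\dim (U + <[v]>)%VS).
  apply/asboolP; exists (U + <[v]>)%VS => // w /memv_addP[u uU [_ /vlineP[c ->] ->]].
  by apply: Padd; [exact: PU|exact: Pscale].
have : U == (U + <[v]>)%VS by rewrite eqEdim addvSl dU maxd.
by move/eqP ->; rewrite memvE addvSr.
Qed.

Section Faces.
Variables (R : realType) (n : nat) (K : set 'cV[R]_n).
Implicit Types (A : 'M[R]_n) (x y z v : 'cV[R]_n) (a b : R) (U : {vspace 'cV[R]_n}).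
Hypothesis Kproper : proper_cone K.

Let Kclosed : closed K. Proof. by case: Kproper. Qed.
Let Kcone : convex_cone K. Proof. by case: Kproper. Qed.

Lemma pointed_eq0 x : K x -> K (- x) -> x = 0.
Proof.
move=> Kx Kx'; have : (K `&` [set y | K (- y)]) x by [].
by case: Kproper => _ _ -> _.
Qed.

(* [U] is the span of the face of [K] generated by [x]. *)
Definition face_span x U : Prop :=
  forall v, v \in U <-> absorbed K v x /\ absorbed K (- v) x.

Lemma face_span_exists x : K x -> exists U, face_span x U.
Proof.
move=> Kx; apply: exists_vspace.
- by rewrite oppr0; split; exists 1; rewrite // scaler0 subr0.
- move=> u v [u1 u2] [v1 v2]; rewrite opprD; split; exact: absorbed_addl.
- move=> a v [v1 v2]; have [a0|/ltW a0] := leP 0 a.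
    by rewrite -scalerN; split; exact: absorbed_scalel.
  rewrite -scaleNr -(opprK (a *: v)) -scaleNr -scalerN.
  by split; apply: absorbed_scalel; rewrite // oppr_ge0.
Qed.

Lemma absorbed_opp x y : K x -> K y -> absorbed K (- y) x.
Proof. by move=> Kx Ky; exists 1 => //; rewrite scale1r opprK; exact: cone_add. Qed.

Lemma face_spanS x z U W :
  face_span x U -> face_span z W -> absorbed K z x -> (W <= U)%VS.
Proof.
move=> sU sW zx; apply/subvP => v /sW[v1 v2]; apply/sU.
by split; apply: absorbed_trans zx.
Qed.

(** Equal dimensions would make the nested spans [W] and [U] equal; then [y], which lies in [U],
    would be absorbed by [z]. *)
Lemma face_span_ltdim x y z U W :
    K x -> K y -> face_span x U -> face_span z W ->
    absorbed K z x -> absorbed K y x -> ~ absorbed K y z ->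
  (\dim W < \dim U)%N.
Proof.
move=> Kx Ky sU sW zx yx yz; rewrite ltnNge; apply/negP => UW.
have /eqP WU : W == U by rewrite eqEdim (face_spanS sU sW zx).
by apply: yz; apply: ((sW y).1 _).1; rewrite WU; apply/sU; split; last exact: absorbed_opp.
Qed.

(** [t] is the largest real with [x - t *: y] in [K]. It exists because [K] is closed and because
    unbounded values would put [- y], the limit of [e *: x - y], in [K], against pointedness.
    Absorption of [y] at this point would allow a larger [t]. *)
Lemma cone_exit x y : K x -> K y -> y != 0 ->
  exists t : R, [/\ 0 <= t, K (x - t *: y) & ~ absorbed K y (x - t *: y)].
Proof.
move=> Kx Ky y0.
pose S := [set t : R | 0 <= t /\ K (x - t *: y)].
have S0 : S 0 by split=> //; rewrite scale0r subr0.
have Sdown s t : S t -> 0 <= s -> s <= t -> S s.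
  move=> [t0 Kt] s0 st; split => //.
  have -> : x - s *: y = (x - t *: y) + (t - s) *: y by rewrite scalerBl addrA subrK.
  by apply: cone_add => //; apply: cone_scale; rewrite ?subr_ge0.
have ubS : has_ubound S.
  apply: contrapT => nub; case/eqP: y0; apply: pointed_eq0 => //.
  have Sall s : 0 <= s -> S s.
    move=> s0; apply: contrapT => nS; apply: nub; exists s => t St.
    by rewrite leNgt; apply/negP => /ltW st; apply: nS; exact: Sdown St _ _.
  have cf : (e *: x - y) @[e --> (0 : R)^'+] --> 0 *: x - y.
    apply: cvgB; last exact: cvg_cst.
    by apply: cvgZr_tmp; exact: cvg_at_right_filter.
  rewrite scale0r sub0r in cf.
  apply: (closed_cvg K Kclosed _ _ cf); near=> e.
  have e0 : 0 < e by near: e; exact: nbhs_right_gt.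
  have [_] := Sall e^-1 (ltW (eq_ind_r is_true e0 (invr_gt0 e))).
  move=> /(cone_scale Kcone (ltW e0)).
  by rewrite scalerBr scalerA mulfV ?gt_eqF // scale1r.
have cS : closed S.
  apply: (@closedI _ [set t : R | 0 <= t] [set t | K (x - t *: y)]).
    exact: closed_ge.
  apply: (@preimage_closed _ _ (fun t : R => x - t *: y)) => //= t _.
  apply: cvgB; first exact: cvg_cst.
  by apply: cvgZr_tmp; exact: cvg_id.
have hS : has_sup S by split => //; exists 0.
have [t0 Kt] : S (sup S) by apply: cS; apply: closure_sup => //; exists 0.
exists (sup S); split => // -[e e0].
rewrite -addrA -opprD -scalerDl => Kte.
suff : sup S + e <= sup S by rewrite gerDl leNgt e0.
apply: (sup_upper_bound hS); split; last exact: Kte.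
by rewrite addr_ge0 // ltW.
Unshelve. all: by end_near. Qed.

Definition extreme_vector x : Prop :=
  [/\ x != 0, K x & forall y, K y -> absorbed K y x -> exists2 c, 0 <= c & y = c *: x].

Lemma extreme_vector_ray x : extreme_vector x -> extreme_rays K (ray x).
Proof.
move=> [x0 Kx ex]; split; last by exists x.
split.
- by move=> _ [c /= c0 <-]; exact: cone_scale.
- split; first by exists 0; exists 0; rewrite /= ?scale0r.
    by move=> _ _ [c /= c0 <-] [d /= d0 <-]; exists (c + d); rewrite ?scalerDl //=; exact: addr_ge0.
  by move=> a _ a0 [c /= c0 <-]; exists (a * c); rewrite ?scalerA //=; exact: mulr_ge0.
- move=> u v Ku Kv [c /= c0 uv].
  suff H w w' : K w -> K w' -> c *: x = w + w' -> ray x w.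
    by split; [apply: (H u v)|apply: (H v u)]; rewrite // uv // addrC.
  move=> Kw Kw'; move: c0; rewrite le_eqVlt => /orP[/eqP <-|c0] E.
    have : w = 0.
      apply: pointed_eq0 => //.
      by rewrite (_ : - w = w') //; apply/eqP; rewrite eq_sym -addr_eq0 addrC -E scale0r.
    by move=> ->; exists 0; rewrite /= ?scale0r.
  have [|d d0 ->] := ex w Kw; last by exists d.
  exists c^-1; first by rewrite invr_gt0.
  rewrite -[X in X - _]scale1r -(mulVf (lt0r_neq0 c0)) -scalerA E scalerDr addrAC subrr add0r.
  by apply: cone_scale => //; rewrite invr_ge0 ltW.
Qed.

Lemma extreme_rays_vector F :
  extreme_rays K F -> exists2 x, extreme_vector x & F = ray x.
Proof.
move=> [[FK Fc Ff] [x x0 Fx]]; exists x => //.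
have rx : F x by rewrite Fx; exists 1; rewrite /= ?scale1r.
split => //; first exact: FK.
move=> y Ky [e e0 Ke].
have [] := Ff (e *: y) (x - e *: y).
- by apply: cone_scale => //; exact: ltW.
- by [].
- by rewrite addrC subrK.
rewrite {1}Fx => -[c /= c0 cE] _; exists (c / e); first by rewrite divr_ge0 // ltW.
by rewrite mulrC -scalerA cE scalerA mulVf ?scale1r // gt_eqF.
Qed.

(* A line through a non-extreme [x] inside a plane section of [K] meets the
   boundary in two points of lower-dimensional faces. *)
Lemma extreme_vectors_generate (P : 'cV[R]_n -> Prop) :
    P 0 -> (forall u v, P u -> P v -> P (u + v)) ->
    (forall a v, 0 <= a -> P v -> P (a *: v)) ->
    (forall v, extreme_vector v -> P v) ->
  forall x, K x -> P x.
Proof.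
move=> P0 Padd Pscale Pext x Kx.
have [U sU] := face_span_exists Kx.
have [d] := ubnP (\dim U); elim: d x U Kx sU => // d IH x U Kx sU dU.
have [->//|x0] := eqVneq x 0.
have [/Pext//|nex] := pselect (extreme_vector x).
have [y [Ky yx ny]] : exists y, [/\ K y, absorbed K y x & forall c, 0 <= c -> y != c *: x].
  apply: contrapT => H; apply: nex; split => // y Ky yx.
  apply: contrapT => H2; apply: H; exists y; split => // c c0.
  by apply/eqP => E; apply: H2; exists c.
(* Subtracting [w] until it is no longer absorbed leads to a face of smaller dimension, where the
   induction hypothesis applies. *)
have step w : K w -> w != 0 -> absorbed K w x ->
    exists t, [/\ 0 <= t, K (x - t *: w), absorbed K (x - t *: w) x & P (x - t *: w)].
  move=> Kw w0 wx; have [t [t0 Kt nt]] := cone_exit Kx Kw w0.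
  have zx : absorbed K (x - t *: w) x.
    by exists 1; rewrite // scale1r opprB addrC subrK; exact: cone_scale.
  exists t; split=> //.
  have [W sW] := face_span_exists Kt; apply: (IH _ W) => //.
  by apply: leq_trans (face_span_ltdim Kx Kw sU sW zx wx nt) _; rewrite -ltnS.
have y0 : y != 0 by have := ny 0; rewrite scale0r; apply.
have [t [t0 Kz zx Pz]] := step y Ky y0 yx.
set z := x - t *: y in Kz zx Pz.
have z0 : z != 0.
  apply/eqP => /eqP; rewrite subr_eq0 => /eqP xE.
  have tn0 : t != 0 by apply: contraNneq x0 => t00; rewrite xE t00 scale0r.
  have := ny t^-1; rewrite xE scalerA mulVf // scale1r eqxx invr_ge0 => /(_ t0).
  by [].
have [s [s0 _ _ Pw]] := step z Kz z0 zx.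
by rewrite -(subrK (s *: z) x); apply: Padd => //; exact: Pscale.
Qed.
End Faces.

(** * The upper bound *)

(** The first repetition occurs at time [t], the number of distinct iterates. If [t - a] were
    [#|T|], then [a = 0] and [T] would be a single cycle, on which [f] is injective. *)
Lemma noninjective_orbit (T : finType) (f : T -> T) (x : T) : ~ injective f ->
  exists a t, [/\ (a < t)%N, (t <= #|T|)%N, (t - a < #|T|)%N & iter a f x = iter t f x].
Proof.
move=> ninj; have /trajectP[a at_ tE] := looping_order f x.
exists a, (order f x); split => //; first exact: max_card.
have tT : (order f x <= #|T|)%N by exact: max_card.
rewrite ltnNge; apply/negP => Tta.
have a0 : a = 0%N by lia.
have oT : order f x = #|T| by lia.
rewrite a0 /= in tE; case: ninj.
suff /image_injP inj : #|[seq f u | u in T]| == #|T| by move=> u v; exact: inj.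
apply/eqP; apply: eq_card => y; rewrite [RHS]inE.
have xy : fconnect f x y.
  have /subset_cardP : #|fconnect f x| = #|T| by [].
  by move=> /(_ (subset_predT _)) /(_ y); rewrite !inE.
have ifx : (findex f x y < order f x)%N by exact: findex_max.
rewrite -(iter_findex xy); case: (findex f x y) => [|k].
  by rewrite /= -tE -(prednK (order_gt0 f x)) iterS; exact: map_f (mem_enum _ _).
by rewrite iterS; exact: map_f (mem_enum _ _).
Qed.

Lemma extreme_rays_enum (R : realType) (n m : nat) (K : set 'cV[R]_n) :
    proper_cone K -> extreme_rays K #= `I_m ->
  exists X : 'I_m -> 'cV[R]_n, (forall i, extreme_vector K (X i)) /\
    forall x, K x -> exists2 c : 'I_m -> R, (forall i, 0 <= c i) & x = \sum_i c i *: X i.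
Proof.
move=> Kp /card_set_bijP[f [ff finj fsurj]].
have hX (i : 'I_m) : exists2 x, extreme_vector K x & f (ray x) = i.
  have [F /(extreme_rays_vector Kp)[x ex ->] fi] := fsurj i (ltn_ord i).
  by exists x.
pose X i := sval (cid2 (hX i)).
have XE i : extreme_vector K (X i) by rewrite /X; case: cid2.
have fX i : f (ray (X i)) = i by rewrite /X; case: cid2.
exists X; split=> //; apply: (extreme_vectors_generate Kp).
- by exists (fun=> 0) => //; rewrite big1 // => i _; rewrite scale0r.
- move=> _ _ [c c0 ->] [d d0 ->]; exists (fun i => c i + d i).
    by move=> i; exact: addr_ge0.
  by rewrite -big_split; apply: eq_bigr => i _; rewrite scalerDl.
- move=> a _ a0 [c c0 ->]; exists (fun i => a * c i); first by move=> i; exact: mulr_ge0.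
  by rewrite scaler_sumr; apply: eq_bigr => i _; rewrite scalerA.
- move=> v ev; have rv := extreme_vector_ray Kp ev.
  have fv : (f (ray v) < m)%N := ff _ rv.
  have : ray v = ray (X (Ordinal fv)).
    by apply: finj; rewrite ?inE ?fX //; exact: (extreme_vector_ray Kp).
  move=> vX; have : ray v v by exists 1; rewrite /= ?scale1r.
  rewrite vX => -[a /= a0 <-]; exists (fun j => if j == Ordinal fv then a else 0).
    by move=> j; case: ifP.
  rewrite (bigD1 (Ordinal fv)) //= eqxx big1 ?addr0 // => j /negPf ->.
  by rewrite scale0r.
Qed.

Section UpperBound.
Variables (R : realType) (n : nat) (K : set 'cV[R]_n).
Hypothesis n2 : (2 <= n)%N.
Hypothesis Kproper : proper_cone K.
Implicit Types (x y z v : 'cV[R]_n).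

Let Kcone : convex_cone K. Proof. by case: Kproper. Qed.

Lemma exists_neq0 : exists v : 'cV[R]_n, v != 0.
Proof.
case: n n2 => // k _; exists (const_mx 1); apply/eqP => /matrixP/(_ ord0 ord0).
by rewrite !mxE => /eqP; rewrite oner_eq0.
Qed.

Lemma interior_neq0 x : interior K x -> x != 0.
Proof.
move=> ix; apply/eqP => x0; have [v /eqP v0] := exists_neq0.
apply: v0; have H w : K w.
  have [e e0] := interior_absorbs ix (- w).
  rewrite x0 sub0r scalerN opprK => Kew.
  by rewrite -(scale1r w) -(mulVf (lt0r_neq0 e0)) -scalerA; apply: cone_scale;
    rewrite // invr_ge0 ltW.
exact: (pointed_eq0 Kproper).
Qed.

(** An interior vector absorbs every vector, so extremality would confine the whole space, of
    dimension at least 2, to a line. *)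
Lemma extreme_not_interior x : extreme_vector K x -> ~ interior K x.
Proof.
move=> [x0 Kx ex] ix.
have inx v : v \in <[x]>%VS.
  have [e e0 Ke] := interior_absorbs ix (- v); rewrite scalerN opprK in Ke.
  have [c c0 cE] := ex _ Ke (interior_absorbs ix _).
  have -> : v = (e^-1 * (c - 1)) *: x.
    by rewrite -scalerA scalerBl scale1r -cE addrAC subrr add0r scalerA mulVf ?scale1r ?gt_eqF.
  exact: rpredZ (memv_line _).
have : (\dim (fullv : {vspace 'cV[R]_n}) <= \dim <[x]>%VS)%N.
  by apply/dimvS/subvP => v _.
by rewrite dimvf dim_matrix dim_vline x0 mulr1 leqNgt n2.
Qed.

Variables (A : 'M[R]_n) (p : nat).
Hypotheses (KA : cone_nonneg K A) (p0 : (0 < p)%N) (Ap : power_positive K A p).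

Lemma powD q r x : A ^+ (q + r) *m x = A ^+ q *m (A ^+ r *m x).
Proof. by rewrite exprD -mulmxE mulmxA. Qed.

(** [z] absorbs [A ^+ p.-1 *m z], hence [A *m z] absorbs [A ^+ p *m z], which is interior. *)
Lemma interior_mulmx z : interior K z -> interior K (A *m z).
Proof.
move=> iz; have z0 := interior_neq0 iz.
have Kz : K z by exact: interior_subset.
have : absorbed K (A ^+ p.-1 *m z) z by exact: interior_absorbs.
move=> /(absorbed_mulmx KA); apply: absorbed_interior => //.
rewrite mulmxA; have -> : A *m A ^+ p.-1 = A ^+ p by rewrite mulmxE -exprS prednK.
exact: Ap.
Qed.

Lemma interior_pow_le q r x :
  (q <= r)%N -> interior K (A ^+ q *m x) -> interior K (A ^+ r *m x).
Proof.
move=> /subnK <-; elim: (r - q)%N => // k IH /IH.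
by rewrite addSn exprS -mulmxE -mulmxA; exact: interior_mulmx.
Qed.

Lemma power_positive_le q r :
  (q <= r)%N -> power_positive K A q -> power_positive K A r.
Proof. by move=> qr Aq x Kx x0; apply: interior_pow_le qr _; exact: Aq. Qed.

Lemma mulmx_neq0 x : K x -> x != 0 -> A *m x != 0.
Proof.
move=> Kx x0; apply/eqP => Ax; have := interior_neq0 (Ap Kx x0).
by rewrite -(prednK p0) exprSr -mulmxE -mulmxA Ax mulmx0 eqxx.
Qed.

Lemma absorbed_pow q x y :
  absorbed K x y -> absorbed K (A ^+ q *m x) (A ^+ q *m y).
Proof. by apply: absorbed_mulmx; exact: cone_nonneg_pow. Qed.

(* The faces generated by [y], [A^s y], [A^(2s) y], ... increase strictly until
   they fill [K], because a repetition would give a proper face stable under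
   [A^s]. *)
Lemma interior_of_return s y : (0 < s)%N -> K y -> y != 0 ->
  absorbed K y (A ^+ s *m y) -> interior K (A ^+ ((n - 1) * s) *m y).
Proof.
move=> s0 Ky y0 ys; apply: contrapT => nint.
have nintk k : (k <= n - 1)%N -> ~ interior K (A ^+ (k * s) *m y).
  by move=> kn /(interior_pow_le _) H; apply/nint/H; rewrite leq_mul2r kn orbT.
have KAk k : K (A ^+ (k * s) *m y) by exact: cone_nonneg_pow.
have inc k : absorbed K (A ^+ (k * s) *m y) (A ^+ (k.+1 * s) *m y).
  by rewrite mulSnr powD; exact: absorbed_pow.
have dimk k : (k <= n - 1)%N ->
    forall U, face_span K (A ^+ (k * s) *m y) U -> (k < \dim U)%N.
  elim: k => [|k IH] kn U sU.
    have yU : y \in U.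
      apply/sU; rewrite mul0n expr0 mul1mx; split; first exact: absorbed_refl.
      exact: (absorbed_opp Kproper).
    rewrite lt0n dimv_eq0; apply/negP => /eqP U0.
    by rewrite U0 memv0 (negPf y0) in yU.
  have [W sW] := face_span_exists Kproper (KAk k).
  apply: leq_ltn_trans (IH (ltnW kn) _ sW) _.
  apply: (face_span_ltdim Kproper (KAk k.+1) (KAk k.+1) sU sW (inc k)).
    exact: absorbed_refl (KAk _).
  (* If the face did not grow at step [k], it would contain all later iterates, and those of
     exponent at least [p] are interior. *)
  move=> back; apply: (nintk k (ltnW kn)).
  have all j : absorbed K (A ^+ ((k + j) * s) *m y) (A ^+ (k * s) *m y).
    elim: j => [|j IHj]; first by rewrite addn0; exact: absorbed_refl.
    apply: absorbed_trans IHj => //.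
    rewrite addnS (_ : (k + j).+1 * s = j * s + k.+1 * s)%N; last by lia.
    rewrite (_ : (k + j) * s = j * s + k * s)%N; last by lia.
    by rewrite (powD (j * s) (k.+1 * s)) (powD (j * s) (k * s)); exact: absorbed_pow.
  apply: absorbed_interior (all p) => //.
  by apply: (@interior_pow_le p); [nia|exact: Ap].
have [U sU] := face_span_exists Kproper (KAk (n - 1)%N).
have dU := dimk _ (leqnn _) _ sU.
have UT : U = fullv.
  by apply/eqP; rewrite eqEdim subvf dimvf dim_matrix mulr1; lia.
apply: nint; case: Kproper => _ _ _ [e ie].
by apply: absorbed_interior ie _ => //; apply: ((sU e).1 _).1; rewrite UT memvf.
Qed.

Variables (m : nat) (X : 'I_m -> 'cV[R]_n).
Hypothesis eX : forall i, extreme_vector K (X i).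
Hypothesis gX : forall x, K x ->
  exists2 c : 'I_m -> R, (forall i, 0 <= c i) & x = \sum_i c i *: X i.

Let KX i : K (X i). Proof. by case: (eX i). Qed.
Let X0 i : X i != 0. Proof. by case: (eX i). Qed.

Lemma exists_absorbed x : K x -> x != 0 -> exists i, absorbed K (X i) x.
Proof.
move=> /gX[c c0 ->] nz.
have [/existsP[i ci]|/existsPn H] := boolP [exists i, c i != 0].
  by exists i; exact: absorbed_sum.
case/eqP: nz; rewrite big1 // => i _.
by have := H i; rewrite negbK => /eqP ->; rewrite scale0r.
Qed.

Lemma walk_absorbed (f : 'I_m -> 'I_m) k i :
    (forall j, absorbed K (X (f j)) (A *m X j)) ->
  absorbed K (X (iter k f i)) (A ^+ k *m X i).
Proof.
move=> fE; elim: k => [|k IH]; first by rewrite mul1mx; exact: absorbed_refl.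
rewrite iterS exprS -mulmxE -mulmxA; apply: absorbed_trans (fE _) _ => //.
exact: absorbed_mulmx.
Qed.

(** Otherwise every choice of successors is injective. Then each vertex has only one successor, [A]
    sends each extreme ray into an extreme ray, and [A ^+ p] sends an extreme vector to a multiple
    of one, which is not interior. *)
Lemma noninjective_walk :
  exists f : 'I_m -> 'I_m, (forall j, absorbed K (X (f j)) (A *m X j)) /\ ~ injective f.
Proof.
have hf i : exists j, absorbed K (X j) (A *m X i).
  by apply: exists_absorbed; [exact: KA|exact: mulmx_neq0].
pose f i := sval (cid (hf i)).
have fE i : absorbed K (X (f i)) (A *m X i) by rewrite /f; case: cid.
apply: contrapT => H.
have injE g : (forall j, absorbed K (X (g j)) (A *m X j)) -> injective g.
  by move=> gE; apply: contrapT => ng; apply: H; exists g.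
have finj := injE f fE.
have uniq_succ k l : absorbed K (X l) (A *m X k) -> l = f k.
  move=> lk; apply: contrapT => lfk.
  (* Redirecting the arc from [k] to [l] still gives a choice of successors; its injectivity forces
     the preimage of [l] under [f] to be [k]. *)
  pose g i := if i == k then l else f i.
  have ginj : injective g.
    by apply: injE => j; rewrite /g; case: eqP => [->|].
  have fK : f (invF finj l) = l by exact: f_invF.
  have : invF finj l = k.
    by apply: ginj; rewrite /g eqxx; case: eqP => // _.
  by move=> E; apply: lfk; rewrite -E fK.
have scal k : exists2 a, 0 <= a & A *m X k = a *: X (f k).
  have [c c0 cE] := gX (KA (KX k)).
  exists (c (f k)) => //; rewrite cE (bigD1 (f k)) //= big1 ?addr0 // => j jf.
  have [->|cj] := eqVneq (c j) 0; first by rewrite scale0r.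
  by case/eqP: jf; apply: uniq_succ; rewrite cE; exact: absorbed_sum.
have [e Ke] : interior K !=set0 by case: Kproper.
have [i _] := exists_absorbed (interior_subset Ke) (interior_neq0 Ke).
have powk k : exists2 a, 0 <= a & A ^+ k *m X i = a *: X (iter k f i).
  elim: k => [|k [a a0 IH]]; first by exists 1; rewrite // mul1mx scale1r.
  have [b b0 bE] := scal (iter k f i); exists (a * b); first exact: mulr_ge0.
  by rewrite exprS -mulmxE -mulmxA IH -scalemxAr bE scalerA iterS.
have [a a0 aE] := powk p.
have iA := Ap (KX i) (X0 i).
apply: (extreme_not_interior (eX (iter p f i))).
apply: (absorbed_interior Kcone iA); rewrite aE.
apply: absorbed_scalel => //; exact: absorbed_refl.
Qed.

Lemma power_positive_bound : power_positive K A ((n - 1) * (m - 1) + 1).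
Proof.
have [f [fE ninj]] := noninjective_walk.
move=> x Kx x0; have [i ix] := exists_absorbed Kx x0.
apply: absorbed_interior (absorbed_pow _ ix) => //.
have [a [t [at_ tm tam tE]]] := noninjective_orbit i ninj.
rewrite card_ord in tm tam.
(* With [s = t - a], the exponent is [(a + s) + (n - 2) s], at most [m + (n - 2) (m - 1) = (n - 1)
   (m - 1) + 1]. *)
apply: (@interior_pow_le ((n - 1) * (t - a) + a)); first by nia.
rewrite powD.
apply: (@absorbed_interior _ _ _ _ (A ^+ ((n - 1) * (t - a)) *m X (iter a f i))) => //.
  apply: interior_of_return => //; first by rewrite subn_gt0.
  rewrite {1}tE -(subnK (ltnW at_)) iterD addnK.
  exact: walk_absorbed.
by apply: absorbed_pow; exact: walk_absorbed.
Qed.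
End UpperBound.

(** * Finitely generated cones and exponents of cones *)

Lemma cvg_sumr (R : numFieldType) (V : normedModType R) (T : Type) (F : set_system T)
    {FF : Filter F} (I : Type) (r : seq I) (P : pred I) (f : I -> T -> V) (l : I -> V) :
    (forall i, P i -> f i x @[x --> F] --> l i) ->
  \sum_(i <- r | P i) f i x @[x --> F] --> \sum_(i <- r | P i) l i.
Proof. by move=> fl; apply: cvg_big => //; exact: add_continuous. Qed.

Section FinitelyGenerated.
Variables (R : realType) (n m : nat) (X : 'I_m -> 'cV[R]_n).

Definition generated_cone : set 'cV[R]_n :=
  [set v | exists2 c : 'I_m -> R, (forall i, 0 <= c i) & v = \sum_i c i *: X i].

Lemma generated_cone_convex : convex_cone generated_cone.
Proof.
split.
- by exists 0; exists (fun=> 0) => //; rewrite big1 // => i _; rewrite scale0r.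
- move=> _ _ [c c0 ->] [d d0 ->]; exists (fun i => c i + d i).
    by move=> i; exact: addr_ge0.
  by rewrite -big_split; apply: eq_bigr => i _; rewrite scalerDl.
- move=> a _ a0 [c c0 ->]; exists (fun i => a * c i); first by move=> i; exact: mulr_ge0.
  by rewrite scaler_sumr; apply: eq_bigr => i _; rewrite scalerA.
Qed.

Lemma generated_cone_gen i : generated_cone (X i).
Proof.
exists (fun j => (j == i)%:R) => //; rewrite (bigD1 i) //= eqxx scale1r big1 ?addr0 //.
by move=> j /negPf ->; rewrite scale0r.
Qed.

Let comb (c : 'rV[R]_m) : 'cV[R]_n := \sum_i c 0 i *: X i.

Let comb_continuous : continuous comb.
Proof.
move=> c; apply: (@cvg_sumr _ _ _ (nbhs c)) => i _.
by apply: cvgZr_tmp; exact: coord_continuous.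
Qed.

Lemma box_compact (M : R) :
  compact [set c : 'rV[R]_m | forall i, 0 <= c 0 i <= M].
Proof.
have := @rV_compact _ m (fun=> `[0, M]%classic) (fun=> @segment_compact _ 0 M).
by congr compact; apply/seteqP; split => c /= cM i; have := cM i; rewrite in_itv.
Qed.

(** [psi] bounds the coefficients: points [w] of the cone close to [v] have coefficient sum [f w]
    below [f v + 1], so they lie in the image of a compact box. *)
Lemma generated_cone_closed (psi : 'rV[R]_n) :
  (forall i, (psi *m X i) 0 0 = 1) -> closed generated_cone.
Proof.
move=> psiX v clv.
pose f (w : 'cV[R]_n) := (psi *m w) 0 0.
have fcont : continuous f.
  have -> : f = fun w => \sum_i psi 0 i * w i 0 by apply/funext => w; rewrite /f mxE.
  move=> w; apply: (@cvg_sumr _ _ _ (nbhs w)) => i _.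
  by apply: cvgM; [exact: cvg_cst|exact: coord_continuous].
have fcomb c : f (\sum_i c i *: X i) = \sum_i c i.
  rewrite /f mulmx_sumr summxE; apply: eq_bigr => i _.
  by rewrite -scalemxAr mxE psiX mulr1.
pose T := [set comb c | c in [set c : 'rV[R]_m | forall i, 0 <= c 0 i <= f v + 1]].
have Tclosed : closed T.
  apply: compact_closed; first exact: norm_hausdorff.
  apply: (@continuous_compact _ _ comb); last exact: box_compact.
  exact: continuous_subspaceT.
suff [c cM <-] : T v by exists (fun i => c 0 i) => // i; case/andP: (cM i).
apply: Tclosed => B nB.
have nf : nbhs v [set w | f w < f v + 1].
  by apply: (cvgr_lt (f v) (fcont v)); rewrite ltrDl.
have [w [[c c0 wE] [Bw fw]]] := clv _ (filterI nB nf).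
exists w; split => //; exists (\row_i c i); last by rewrite /comb wE; apply: eq_bigr => i _;
  rewrite mxE.
move=> i /=; rewrite mxE c0 /= ltW //; apply: le_lt_trans fw.
by rewrite wE fcomb (bigD1 i) //= lerDl sumr_ge0.
Qed.

(* Gordan's alternative: the point of the convex hull of the generators nearest
   to the origin. *)
Lemma exists_positive_functional :
    (forall c : 'I_m -> R, (forall i, 0 <= c i) -> \sum_i c i *: X i = 0 ->
       forall i, c i = 0) ->
  exists psi : 'rV[R]_n, forall i, 0 < (psi *m X i) 0 0.
Proof.
move=> indep.
have [/existsP[i0 _]|/existsPn none] := boolP [exists i : 'I_m, true]; last first.
  by exists 0 => i; have := none i.
pose S := [set c : 'rV[R]_m | (forall i, 0 <= c 0 i <= 1) /\ \sum_i c 0 i = 1].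
pose dot (u v : 'cV[R]_n) := \sum_k u k 0 * v k 0.
have dotC u v : dot u v = dot v u by apply: eq_bigr => k _; rewrite mulrC.
have dotD u v w : dot u (v + w) = dot u v + dot u w.
  by rewrite -big_split; apply: eq_bigr => k _; rewrite mxE mulrDr.
have dotZ a u v : dot u (a *: v) = a * dot u v.
  by rewrite mulr_sumr; apply: eq_bigr => k _; rewrite mxE mulrCA.
have dot0 u : 0 <= dot u u by apply: sumr_ge0 => k _; rewrite -expr2 sqr_ge0.
have dot_gt0 u : u != 0 -> 0 < dot u u.
  move=> u0; rewrite lt_def dot0 andbT; apply: contra u0 => /eqP u0.
  apply/eqP/matrixP => i j; rewrite ord1 mxE; apply/eqP.
  have /psumr_eq0P/(_ u0 i isT)/eqP : forall k, true -> 0 <= u k 0 * u k 0.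
    by move=> k _; rewrite -expr2 sqr_ge0.
  by rewrite -expr2 sqrf_eq0.
have sumcont : continuous (fun c : 'rV[R]_m => \sum_i c 0 i).
  by move=> c; apply: (@cvg_sumr _ _ _ (nbhs c)) => i _; exact: coord_continuous.
have S1 : S !=set0.
  exists (delta_mx 0 i0); split => [i|]; first by rewrite mxE eqxx /=; case: eqP => _ /=;
    rewrite ?ler01 lexx.
  rewrite (bigD1 i0) //= mxE !eqxx big1 ?addr0 // => j /negPf ji.
  by rewrite mxE ji andbF.
have Scpt : compact S.
  have Scl : closed S.
    apply: closedI; first exact: (compact_closed (@norm_hausdorff _ _) (@box_compact 1)).
    apply: (@preimage_closed _ _ (fun c : 'rV[R]_m => \sum_i c 0 i) [set 1]) => //.
  by apply: (subclosed_compact Scl (@box_compact 1)) => c [].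
have dcont : {within S, continuous (fun c => dot (comb c) (comb c))}.
  apply: continuous_subspaceT => c; apply: (@cvg_sumr _ _ _ (nbhs c)) => k _.
  have cc : comb c0 k 0 @[c0 --> c] --> comb c k 0.
    by apply: (@continuous_comp _ _ _ comb (fun M : 'cV[R]_n => M k 0));
      [exact: comb_continuous|exact: coord_continuous].
  exact: cvgM.
have [c] := compact_EVT_min S1 Scpt dcont; rewrite inE => -[cS cS1] cmin.
pose q := comb c.
have q0 : q != 0.
  apply/eqP => /indep H; have c0 i : c 0 i = 0 by apply: H => j; case/andP: (cS j).
  by have := cS1; rewrite big1 // => /eqP; rewrite eq_sym oner_eq0.
exists (q^T) => i.
have -> : (q^T *m X i) 0 0 = dot q (X i) by rewrite mxE; apply: eq_bigr => k _; rewrite mxE.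
apply: lt_le_trans (dot_gt0 _ q0) _.
have [d dE] : exists d, d = X i - q by eexists.
suff : 0 <= dot q d.
  have -> : dot q d = dot q (X i) - dot q q.
    by rewrite dE dotD -scaleN1r dotZ mulN1r.
  by rewrite subr_ge0.
rewrite leNgt; apply/negP => B0.
(* Minimality of [q] along the segment from [q] to [X i]: the squared norm of [q + t *: d] is at
   least that of [q]. *)
have key t : 0 <= t -> t <= 1 -> 0 <= 2 * t * dot q d + t ^+ 2 * dot d d.
  move=> t0 t1.
  pose c' := (1 - t) *: c + t *: delta_mx 0 i.
  have c'E j : c' 0 j = (1 - t) * c 0 j + t * (j == i)%:R by rewrite !mxE.
  have c'S : c' \in S.
    rewrite inE; split => [j|].
      rewrite c'E; have /andP[u1 u2] := cS j.
      have v0 : 0 <= (j == i)%:R :> R by case: eqP.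
      have v1 : (j == i)%:R <= 1 :> R by case: eqP.
      by apply/andP; split; nra.
    under eq_bigr do rewrite c'E.
    rewrite big_split /= -!mulr_sumr cS1 (bigD1 i) //= eqxx big1 ?addr0 ?mulr1 ?subrK //.
    by move=> j /negPf ->.
  have := cmin _ c'S.
  have -> : comb c' = q + t *: d.
    rewrite /comb; under eq_bigr do rewrite c'E scalerDl -!scalerA.
    rewrite big_split /= -!scaler_sumr -/(comb c) -/q scalerBl scale1r dE scalerBr addrA addrAC.
    congr (_ + _ + _); rewrite (bigD1 i) //= eqxx scale1r big1 ?addr0 //.
    by move=> j /negPf ->; rewrite scale0r.
  rewrite dotD dotZ !(dotC (q + t *: d)) !dotD !dotZ (dotC d q) -/q -subr_ge0.
  by congr (0 <= _); ring.
set B := dot q d in B0 key; set D := dot d d in key.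
have D0 : 0 <= D by exact: dot0.
have DB : 0 < D - B by lra.
(* The quadratic in [t] would be least at [- B / D]; the denominator [D - B] is nonzero even if
   [D = 0], keeps the point at most 1 and still gives a negative value. *)
have t0 : 0 <= - B / (D - B) by rewrite divr_ge0 ?oppr_ge0 ?(ltW B0) ?(ltW DB).
have t1 : - B / (D - B) <= 1 by rewrite ler_pdivrMr // mul1r; lra.
have := key _ t0 t1.
have -> : 2 * (- B / (D - B)) * B + (- B / (D - B)) ^+ 2 * D =
    (B / (D - B)) ^+ 2 * (2 * B - D) by field; rewrite lt0r_neq0.
rewrite leNgt => /negP; apply; rewrite pmulr_rlt0; first by lra.
by rewrite -sqrrN -mulNr exprn_gt0 // divr_gt0 ?oppr_gt0.
Qed.
End FinitelyGenerated.

Section ConeExponent.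
Variables (R : realType) (n : nat) (K : set 'cV[R]_n).
Hypothesis n2 : (2 <= n)%N.
Implicit Types (A : 'M[R]_n).

Lemma exponent_exists A : cone_primitive K A -> exists p, is_exponent K A p.
Proof.
move=> [KA [p p0 Ap]].
pose Q k := (0 < k)%N && `[< power_positive K A k >].
have exQ : exists k, Q k by exists p; rewrite /Q p0; apply/asboolP.
case: (ex_minnP exQ) => k /andP[k0 /asboolP Ak] mink.
exists k; split=> // q q0 Aq; apply: mink; rewrite /Q q0; exact/asboolP.
Qed.

Section FixedRays.
Variable m : nat.
Hypotheses (Kproper : proper_cone K) (Krays : extreme_rays K #= `I_m).

Lemma exponent_bound A p : cone_primitive K A -> is_exponent K A p ->
  (p <= (n - 1) * (m - 1) + 1)%N.
Proof.
move=> [KA [q q0 Aq]] [_ _]; apply; first by rewrite addn1.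
have [X [eX gX]] := extreme_rays_enum Kproper Krays.
exact: (power_positive_bound n2 Kproper KA q0 Aq eX gX).
Qed.

(** The rank-one matrix [e *m psi], with [e] interior and [psi] positive on the extreme vectors,
    sends every nonzero vector of [K] to a positive multiple of [e]. *)
Lemma exists_primitive : exists A, cone_primitive K A.
Proof.
have Kcone : convex_cone K by case: Kproper.
have [X [eX gX]] := extreme_rays_enum Kproper Krays.
have KX i : K (X i) by case: (eX i).
have [|psi psi0] := @exists_positive_functional _ _ _ X.
  move=> c c0 cX i; apply/eqP; apply: contraT => ci.
  have [/eqP + _ _] := eX i; case.
  have : c i *: X i = 0.
    apply: (pointed_eq0 Kproper); first exact: cone_scale.
    have -> : - (c i *: X i) = \sum_(j | j != i) c j *: X j.
      by have := cX; rewrite (bigD1 i) //= => /eqP; rewrite addr_eq0 => /eqP ->; rewrite opprK.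
    by apply: cone_sum => // j _; exact: cone_scale.
  by move/eqP; rewrite scaler_eq0 (negPf ci) => /eqP.
have [e Ke] : interior K !=set0 by case: Kproper.
have AE x : (e *m psi) *m x = (psi *m x) 0 0 *: e.
  by rewrite -mulmxA {1}[psi *m x]mx11_scalar mul_mx_scalar.
have psiK x : K x -> 0 <= (psi *m x) 0 0.
  move=> /gX[c c0 ->]; rewrite mulmx_sumr summxE sumr_ge0 // => i _.
  by rewrite -scalemxAr mxE mulr_ge0 // ltW.
exists (e *m psi); split.
  by move=> x Kx; rewrite AE; apply: cone_scale => //; [exact: psiK|exact: interior_subset].
exists 1%N => // x Kx x0; rewrite expr1 AE -[X in interior _ X]addr0.
apply: interior_scale_add => //; last exact: cone0.
have [i [d d0 Kd]] := exists_absorbed Kproper eX gX Kx x0.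
have -> : x = (x - d *: X i) + d *: X i by rewrite subrK.
rewrite mulmxDr mxE ltr_wpDl ?psiK // -scalemxAr mxE mulr_gt0 //.
Qed.

Lemma cone_exponent_exists :
  exists2 g, is_cone_exponent K g & (g <= (n - 1) * (m - 1) + 1)%N.
Proof.
have [A KA] := exists_primitive; have [p Ap] := exponent_exists KA.
pose Q k := `[< exists2 A, cone_primitive K A & is_exponent K A k >].
have exQ : exists k, Q k by exists p; apply/asboolP; exists A.
have ubQ k : Q k -> (k <= (n - 1) * (m - 1) + 1)%N.
  by move=> /asboolP[B KB Bk]; exact: exponent_bound KB Bk.
case: (ex_maxnP exQ ubQ) => g Qg maxg; exists g; last exact: ubQ.
split; first exact/asboolP.
by move=> B q KB Bq; apply: maxg; apply/asboolP; exists B.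
Qed.

End FixedRays.

Lemma cone_exponent_gt A q g : proper_cone K -> cone_primitive K A -> ~ power_positive K A q ->
  is_cone_exponent K g -> (q < g)%N.
Proof.
move=> Kproper pA nAq [_ gmax]; have [p Ap] := exponent_exists pA.
apply: leq_trans (gmax _ _ pA Ap); rewrite ltnNge; apply/negP => pq; apply: nAq.
case: pA Ap => KA _ [p0 pp _].
exact: (power_positive_le n2 Kproper KA p0 pp pq).
Qed.
(** A generator occurring with nonzero contribution in an extreme vector is absorbed by it, hence
    spans its ray; so every extreme ray comes from a generator. *)
Lemma generated_cone_rays (m : nat) (X : 'I_m -> 'cV[R]_n) :
    K = generated_cone X -> proper_cone K ->
  exists2 m', extreme_rays K #= `I_m' & (m' <= m)%N.
Proof.
move=> KE Kproper; have Kcone : convex_cone K by case: Kproper.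
have sub : extreme_rays K `<=`
    [set (if insub k is Some i then ray (X i) else set0) | k in `I_m].
  move=> F /(extreme_rays_vector Kproper)[x [x0 Kx ex] ->].
  have [c c0 cE] : generated_cone X x by rewrite -KE.
  have [/existsP[i ci]|/existsPn H] := boolP [exists i, c i *: X i != 0]; last first.
    by case/eqP: x0; rewrite cE big1 // => i _; apply/eqP; rewrite -[_ == _]negbK; exact: H.
  exists i => //=; rewrite valK.
  have KX j : K (X j) by rewrite KE; exact: generated_cone_gen.
  have [|a a0 aE] := ex (X i) (KX i).
    exists (c i); first by rewrite lt_def c0 andbT; apply: contraNneq ci => ->; rewrite scale0r.
    rewrite cE (bigD1 i) //= addrAC subrr add0r.
    by apply: cone_sum => // j _; exact: cone_scale.
  have an0 : a != 0 by apply: contraNneq ci => az; rewrite aE az scale0r scaler0.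
  apply/seteqP; split => _ [b /= b0 <-].
    exists (b * a); first exact: mulr_ge0 b0 a0.
    by rewrite -scalerA -aE.
  exists (b / a); first exact: divr_ge0 b0 a0.
  by rewrite aE scalerA divfK.
have le1 : extreme_rays K #<= `I_m.
  exact: card_le_trans (subset_card_le sub) (card_image_le _ _).
have [m' m'E] : exists m', extreme_rays K #= `I_m'.
  by apply/finite_setP; apply: card_le_finite le1 _; exact: finite_II.
exists m' => //.
have := m'E; rewrite -card_le_II card_eq_le => /andP[_ /card_le_trans]; exact.
Qed.

(* Were fewer than [m] of the generators extreme, the upper bound for the true
   number of extreme rays would be at most [q]. *)
Lemma generated_polyhedral_cone (m : nat) (X : 'I_m -> 'cV[R]_n) A (q : nat) :
    (3 <= n)%N -> (3 <= m)%N -> ((n - 1) * (m - 1) <= q + 1)%N ->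
    K = generated_cone X -> proper_cone K -> cone_primitive K A ->
    ~ power_positive K A q ->
  polyhedral_cones m K.
Proof.
move=> n3 m3 qb KE Kproper.
have [m' m'E m'm] := generated_cone_rays KE Kproper.
have [<-|m'ltm] : m' = m \/ (m' < m)%N by lia.
  by move=> _ _; split.
have [Y [eY gY]] := extreme_rays_enum Kproper m'E.
(* Each missing ray lowers the bound by [n - 1 >= 2], which covers the final [+ 1] and the slack of
   one allowed in [q]. *)
have le : ((n - 1) * (m' - 1) + 1 <= q)%N by nia.
move=> [KA [p p0 Ap]] [].
exact: (power_positive_le n2 Kproper KA p0 Ap le (power_positive_bound n2 Kproper KA p0 Ap eY gY)).
Qed.
End ConeExponent.

(** * The cone generated by powers of a root of a trinomial *)

Section CompanionCone.
Variables (R : realType) (n m : nat) (g : {poly R}) (E : R).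
Hypotheses (n3 : (3 <= n)%N) (nm : (n <= m)%N) (E0 : 0 < E).
Hypotheses (size_g : size g = n.+1) (g1 : g.[1] = 0).
Hypothesis g_dvd : g %| 'X^m + E *: 'X^(m - 1) - (1 + E)%:P.
Implicit Types (p q : {poly R}).

(** Coordinates of the class of [p] modulo [g] in the basis [1, X, ..., X^(n-1)]. *)
Definition modvec p : 'cV[R]_n := \col_i (p %% g)`_i.

Let g_neq0 : g != 0. Proof. by rewrite -size_poly_eq0 size_g. Qed.
Let E1 : 1 + E != 0. Proof. by rewrite lt0r_neq0 // addr_gt0. Qed.

Lemma modvecD p q : modvec (p + q) = modvec p + modvec q.
Proof. by apply/matrixP => i j; rewrite !mxE modpD coefD. Qed.

Lemma modvecZ a p : modvec (a *: p) = a *: modvec p.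
Proof. by apply/matrixP => i j; rewrite !mxE modpZl coefZ. Qed.

Lemma modvec_sum (I : Type) (r : seq I) (P : pred I) (F : I -> {poly R}) :
  modvec (\sum_(i <- r | P i) F i) = \sum_(i <- r | P i) modvec (F i).
Proof.
apply: (big_morph _ modvecD); apply/matrixP => i j.
by rewrite !mxE mod0p coef0.
Qed.

Lemma modvec_small p (i : 'I_n) : (size p <= n)%N -> modvec p i 0 = p`_i.
Proof. by move=> sp; rewrite mxE modp_small // size_g. Qed.

(* Multiplication by [recip] is the inverse of multiplication by ['X] modulo
   [g], since [g] divides ['X^m + E 'X^(m-1) - (1 + E)]. *)
Definition recip : {poly R} := (1 + E)^-1 *: ('X^(m - 1) + E *: 'X^(m - 2)).

Definition recip_mx : 'M[R]_n := \matrix_(i, j) ((recip * 'X^j) %% g)`_i.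

Lemma size_modp p : (size (p %% g)%R <= n)%N.
Proof. by rewrite -ltnS -size_g ltn_modp. Qed.

Lemma recip_mxE p : recip_mx *m modvec p = modvec (recip * p).
Proof.
apply/matrixP => i k; rewrite !mxE -modp_mul.
rewrite [in RHS](_ : p %% g = \sum_(j < n) (p %% g)`_j *: 'X^j); last first.
  rewrite -(poly_def n (fun j => (p %% g)`_j)); apply/polyP => j; rewrite coef_poly.
  by case: ltnP => // nj; rewrite nth_default //; exact: leq_trans (size_modp _) nj.
rewrite mulr_sumr (big_morph _ (modpD g) (mod0p g)) coef_sum.
by apply: eq_bigr => j _; rewrite !mxE -scalerAr modpZl coefZ mulrC.
Qed.

Lemma recip_mx_pow k p : recip_mx ^+ k *m modvec p = modvec (recip ^+ k * p).
Proof.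
elim: k p => [|k IH] p; first by rewrite !expr0 mul1mx mul1r.
by rewrite exprS -mulmxE -mulmxA IH recip_mxE mulrA -exprS.
Qed.

Lemma modvec_eq p q : g %| p - q -> modvec p = modvec q.
Proof.
rewrite -[p in modvec p](subrK q) modvecD => /modp_eq0P pq.
by apply/matrixP => i j; rewrite !mxE pq coef0 add0r.
Qed.

Let m1S : (m - 1).+1 = m. Proof. by lia. Qed.
Let m2S : (m - 2).+1 = (m - 1)%N. Proof. by lia. Qed.

Let scale1E : (1 + E)^-1 *: (1 + E)%:P = 1 :> {poly R}.
Proof. by rewrite -mul_polyC -polyCM mulVf. Qed.

Lemma recipX_dvd : g %| recip * 'X - 1.
Proof.
have -> : recip * 'X - 1 = (1 + E)^-1 *: ('X^m + E *: 'X^(m - 1) - (1 + E)%:P).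
  rewrite scalerBr -scalerAl mulrDl -scalerAl -!exprSr.
  rewrite m1S m2S.
  by rewrite scale1E.
by rewrite dvdpZr ?invr_eq0.
Qed.

Lemma modvec_recipX k p : modvec ((recip * 'X) ^+ k * p) = modvec p.
Proof.
apply: modvec_eq; rewrite -[p in _ - p]mul1r -mulrBl dvdp_mulr //.
by rewrite -(expr1n _ k) subrXX dvdp_mulr ?recipX_dvd.
Qed.

(** Represents [X^-(m-1)] modulo [g], because [X^(m-1) (X + E)] is congruent to [1 + E]. *)
Let v : {poly R} := (1 + E)^-1 *: ('X + E%:P).

Lemma modvec_recip_pow k p : modvec (recip ^+ (k * (m - 1)) * p) = modvec (v ^+ k * p).
Proof.
rewrite -(modvec_recipX (k * (m - 1))) -[RHS](modvec_recipX (k * (m - 1))).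
apply: modvec_eq; rewrite -mulrBr dvdp_mull //.
rewrite -mulrBl dvdp_mulr // mulnC !exprM subrXX dvdp_mulr //.
(* Both [recip ^+ (m - 1)] and [v] are inverses of ['X^(m - 1)] modulo [g]; this is the uniqueness
   of inverses written out. *)
have -> : recip ^+ (m - 1) - v =
    (recip ^+ (m - 1) * (1 - v * 'X^(m - 1))) + v * ((recip * 'X) ^+ (m - 1) - 1).
  by rewrite exprMn; ring.
apply: dvdp_add; apply: dvdp_mull; last first.
  by rewrite -(expr1n _ (m - 1)) subrXX dvdp_mulr ?recipX_dvd.
have -> : 1 - v * 'X^(m - 1) = - (1 + E)^-1 *: ('X^m + E *: 'X^(m - 1) - (1 + E)%:P).
  rewrite scaleNr scalerBr opprB scale1E; congr (_ - _).
  rewrite -scalerAl mulrDl -exprS mul_polyC.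
  by rewrite m1S.
by rewrite dvdpZr ?oppr_eq0 ?invr_eq0.
Qed.

Definition companion_gen (j : 'I_m) : 'cV[R]_n := modvec 'X^j.

Lemma modvec_comb p : (size p <= m)%N -> modvec p = \sum_(j < m) p`_j *: companion_gen j.
Proof.
move=> sp; have -> : p = \sum_(j < m) p`_j *: 'X^j.
  rewrite -(poly_def m (fun j => p`_j)); apply/polyP => j; rewrite coef_poly.
  by case: ltnP => // mj; rewrite nth_default //; exact: leq_trans sp mj.
rewrite modvec_sum; apply: eq_bigr => j _; rewrite modvecZ; congr (_ *: _).
rewrite coef_sum (bigD1 j) //= coefZ coefXn eqxx mulr1 big1 ?addr0 // => i ij.
by rewrite coefZ coefXn eq_sym (inj_eq val_inj) (negPf ij) mulr0.
Qed.

Definition companion_cone : set 'cV[R]_n := generated_cone companion_gen.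

Let K := companion_cone.
Let Kcone : convex_cone K. Proof. exact: generated_cone_convex. Qed.
Let Kgen j : K (companion_gen j). Proof. exact: generated_cone_gen. Qed.

(** Evaluation at 1 factors through the quotient because [g.[1] = 0]. It takes the value 1 on every
    generator, which yields closedness and pointedness of the cone. *)
Lemma companion_eval p : ((const_mx 1 : 'rV[R]_n) *m modvec p) 0 0 = p.[1].
Proof.
rewrite mxE (divp_eq p g) hornerD hornerM g1 mulr0 add0r.
rewrite (horner_coef_wide _ (size_modp p)) -divp_eq.
by apply: eq_bigr => i _; rewrite !mxE expr1n mul1r mulr1.
Qed.

Lemma companion_cone_coord (v' : 'cV[R]_n) : (forall i, 0 <= v' i 0) -> K v'.
Proof.
move=> v0; exists (fun j => if insub (val j) is Some i then v' i 0 else 0).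
  by move=> j; case: insubP.
pose p := \poly_(j < n) (if insub j is Some i then v' i 0 else 0).
have sp : (size p <= n)%N by exact: size_poly.
transitivity (modvec p).
  by apply/matrixP => i k; rewrite ord1 modvec_small // coef_poly ltn_ord valK.
rewrite modvec_comb; last exact: leq_trans sp nm.
apply: eq_bigr => j _; rewrite coef_poly; congr (_ *: _).
by case: insubP => [i ->//|/negPf ->].
Qed.

Lemma companion_interior_const : interior K (const_mx 1).
Proof.
exists (fun _ _ => [set x : R | 0 <= x]) => [i j|M M0]; last first.
  by apply: companion_cone_coord => i; exact: M0.
by rewrite mxE; exact: lt_le_nbhsr ltr01.
Qed.

Lemma companion_const : (const_mx 1 : 'cV[R]_n) = \sum_(i < n) modvec 'X^i.
Proof.
apply/matrixP => i k; rewrite ord1 mxE summxE (bigD1 i) //= modvec_small ?size_polyXn // coefXn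
  eqxx.
rewrite big1 ?addr0 // => j ji; rewrite modvec_small ?size_polyXn //.
by rewrite coefXn eq_sym (inj_eq val_inj) (negPf ji).
Qed.

Lemma companion_interior_gens y : K y ->
  (forall j, absorbed K (companion_gen j) y) -> interior K y.
Proof.
move=> Ky ay; apply: (absorbed_interior Kcone companion_interior_const).
rewrite companion_const; elim/big_ind: _.
- by exists 1; rewrite // scaler0 subr0.
- by move=> u u' ? ?; exact: absorbed_addl.
- by move=> i _; exact: (ay (widen_ord nm i)).
Qed.

Lemma companion_proper : proper_cone K.
Proof.
have psi1 j : ((const_mx 1 : 'rV[R]_n) *m companion_gen j) 0 0 = 1.
  by rewrite companion_eval hornerXn expr1n.
split=> //; first exact: generated_cone_closed psi1.
- apply/seteqP; split => x; last first.
    by move=> ->; split; rewrite /= ?oppr0; exact: cone0.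
  have psiK c : ((const_mx 1 : 'rV[R]_n) *m (\sum_j c j *: companion_gen j)) 0 0 = \sum_j c j.
    rewrite mulmx_sumr summxE; apply: eq_bigr => i _.
    by rewrite -scalemxAr mxE psi1 mulr1.
  move=> [[c c0 xE] [d d0 dE]]; rewrite /= xE big1 // => j _.
  suff -> : c j = 0 by rewrite scale0r.
  have : \sum_j c j = 0.
    apply/eqP; rewrite eq_le sumr_ge0 // andbT -psiK -xE -[x]opprK mulmxN mxE oppr_le0.
    by rewrite dE psiK sumr_ge0.
  by move/psumr_eq0P => ->.
- by exists (const_mx 1); exact: companion_interior_const.
Qed.

(** Multiplication by [X^-1] shifts [X^(j+1)] to [X^j] and sends [1] to a nonnegative combination of
    [X^(m-1)] and [X^(m-2)]. *)
Lemma recip_mx_nonneg : cone_nonneg K recip_mx.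
Proof.
move=> _ [c c0 ->]; rewrite mulmx_sumr; apply: cone_sum => // j _.
rewrite -scalemxAr; apply: cone_scale => //; rewrite recip_mxE.
case: j => -[|j] jm /=.
  rewrite expr0 mulr1 modvecZ modvecD modvecZ; apply: cone_scale => //.
    by rewrite invr_ge0 addr_ge0 // ltW.
  have m1 : (m - 1 < m)%N by lia.
  have m2 : (m - 2 < m)%N by lia.
  apply: cone_add => //; first exact: (Kgen (Ordinal m1)).
  by apply: cone_scale; rewrite ?(ltW E0) //; exact: (Kgen (Ordinal m2)).
have := modvec_recipX 1 'X^j; rewrite expr1 -mulrA -exprS => ->.
exact: (Kgen (Ordinal (ltnW jm))).
Qed.

(** Each generator [X^j] is the image of [X^(j+1)], which an interior point absorbs whether or not
    it lies in [K]. *)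
Lemma recip_mx_interior y : interior K y -> interior K (recip_mx *m y).
Proof.
move=> iy; apply: companion_interior_gens => [|j].
  by apply: recip_mx_nonneg; exact: interior_subset.
have -> : companion_gen j = recip_mx *m modvec ('X * 'X^j).
  by rewrite recip_mxE mulrA -(expr1 (recip * 'X)) modvec_recipX.
by apply: absorbed_mulmx; [exact: recip_mx_nonneg|exact: interior_absorbs].
Qed.

Lemma XaddE_coef_ge0 k j : 0 <= (('X + E%:P) ^+ k)`_j.
Proof.
elim: k j => [|k IH] j; first by rewrite expr0 coef1; case: eqP.
rewrite exprS mulrDl coefD coefXM coefCM addr_ge0 ?mulr_ge0 ?(ltW E0) //.
by case: ifP.
Qed.

Lemma XaddE_coef_gt0 k j : (j <= k)%N -> 0 < (('X + E%:P) ^+ k)`_j.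
Proof.
elim: k j => [|k IH] j; first by rewrite leqn0 => /eqP ->; rewrite expr0 coef1 ltr01.
rewrite exprS mulrDl coefD coefXM coefCM; case: j => [|j] jk /=.
  by rewrite add0r mulr_gt0 // IH.
by rewrite ltr_wpDr ?IH // mulr_ge0 ?(ltW E0) ?XaddE_coef_ge0.
Qed.

Lemma size_vX k : (size (v ^+ k) <= k.+1)%N.
Proof.
elim: k => [|k IH]; first by rewrite expr0 size_poly1.
rewrite exprS; apply: leq_trans (size_polyMleq _ _) _.
have : (size v <= 2)%N by apply: leq_trans (size_scale_leq _ _) _; rewrite size_XaddC.
by move: IH; case: (size v) => [|[|[|]]] //= ? _; lia.
Qed.

(** The power [(m - 1) * (m - 1) + j] sends [X^j] to [v ^+ (m - 1)], whose [m] coefficients are all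
    positive, so that it absorbs every generator. *)
Lemma recip_mx_primitive : cone_primitive K recip_mx.
Proof.
split; first exact: recip_mx_nonneg.
exists ((m - 1) * (m - 1) + m)%N; first by lia.
have mono (q r : nat) y : (q <= r)%N -> interior K (recip_mx ^+ q *m y) ->
    interior K (recip_mx ^+ r *m y).
  move=> /subnK <-; elim: (r - q)%N => [|k IH]; first by rewrite add0n.
  by move=> /IH; rewrite addSn exprS -mulmxE -mulmxA; exact: recip_mx_interior.
have gens j : interior K (recip_mx ^+ ((m - 1) * (m - 1) + m) *m companion_gen j).
  apply: (mono ((m - 1) * (m - 1) + j)%N); first by rewrite leq_add2l ltnW.
  rewrite recip_mx_pow exprD -mulrA modvec_recip_pow -exprMn mulrC modvec_recipX.
  have sv : (size (v ^+ (m - 1)) <= m)%N by apply: leq_trans (size_vX _) _; lia.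
  have vc i : (i < m)%N -> 0 < (v ^+ (m - 1))`_i.
    move=> im; rewrite exprZn coefZ mulr_gt0 ?XaddE_coef_gt0 //; last by lia.
    by rewrite exprn_gt0 // invr_gt0 addr_gt0.
  have vc0 (i : 'I_m) : 0 <= (v ^+ (m - 1))`_i by rewrite ltW // vc.
  rewrite modvec_comb //; apply: companion_interior_gens => [|i].
    by exists (fun i : 'I_m => (v ^+ (m - 1))`_i).
  by apply: (absorbed_sum Kcone (c := fun i : 'I_m => (v ^+ (m - 1))`_i)) => //;
    rewrite lt0r_neq0 // vc.
move=> x [c c0 xE] x0.
have [/existsP[i ci]|/existsPn H] := boolP [exists i, c i != 0]; last first.
  case/eqP: x0; rewrite xE big1 // => i _.
  by have := H i; rewrite negbK => /eqP ->; rewrite scale0r.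
apply: (absorbed_interior Kcone (gens i)); apply: absorbed_mulmx.
  by apply: cone_nonneg_pow; exact: recip_mx_nonneg.
by rewrite xE; exact: absorbed_sum.
Qed.

(** Coordinate [i0] is nonnegative on [K] and vanishes at the image of [X^(m-1)], which is therefore
    a boundary point. *)
Lemma companion_not_positive (q : nat) (r : {poly R}) (i0 : 'I_n) :
    (forall j, (j < m)%N -> 0 <= ('X^j %% g)`_i0) ->
    modvec (recip ^+ q * 'X^(m - 1)) = modvec r -> (size r <= n)%N -> r`_i0 = 0 ->
  ~ power_positive K recip_mx q.
Proof.
move=> pos qr sr ri0 pp.
have m1 : (m - 1 < m)%N by lia.
have xn0 : companion_gen (Ordinal m1) != 0.
  apply/eqP => x0; have := companion_eval 'X^(m - 1).
  by rewrite -[modvec _]/(companion_gen (Ordinal m1)) x0 mulmx0 mxE hornerXn expr1n => /eqP;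
    rewrite eq_sym oner_eq0.
have := pp _ (Kgen (Ordinal m1)) xn0; rewrite recip_mx_pow qr => /interior_absorbs.
move=> /(_ (delta_mx i0 0))[e e0 [c c0 /matrixP/(_ i0 0)]].
rewrite !mxE !eqxx modp_small ?size_g // ri0 mulr1 sub0r => eE.
have : 0 <= - e.
  rewrite eE summxE sumr_ge0 // => j _; rewrite mxE mulr_ge0 //.
  by rewrite mxE; exact: pos.
by rewrite oppr_ge0 leNgt e0.
Qed.

Lemma recip_pow_last :
  modvec (recip ^+ ((n - 1) * (m - 1)) * 'X^(m - 1)) = modvec (v ^+ (n - 2)).
Proof.
rewrite (_ : (n - 1) * (m - 1) = (n - 2) * (m - 1) + (m - 1))%N; last by nia.
by rewrite exprD -mulrA modvec_recip_pow -exprMn mulrC modvec_recipX.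
Qed.

Lemma recip_pow_last_pred :
  modvec (recip ^+ ((n - 1) * (m - 1) - 1) * 'X^(m - 1)) = modvec (v ^+ (n - 2) * 'X).
Proof.
rewrite (_ : (n - 1) * (m - 1) - 1 = (n - 2) * (m - 1) + (m - 2))%N; last by nia.
rewrite exprD -mulrA modvec_recip_pow [X in 'X^X](_ : _ = (m - 2).+1); last by lia.
by rewrite exprSr (mulrA (recip ^+ _)) -exprMn mulrCA modvec_recipX.
Qed.

(** The boundary point is [v ^+ (n - 2)], whose degree is too small for a coordinate [n - 1]. *)
Lemma companion_cone_last :
    (forall j, (j < m)%N -> 0 <= ('X^j %% g)`_(n - 1)) ->
  polyhedral_cones m K /\
  forall N, is_cone_exponent K N -> ((n - 1) * (m - 1) < N)%N.
Proof.
move=> pos; have n1 : (n - 1 < n)%N by lia.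
have sv : (size (v ^+ (n - 2)) <= n - 1)%N by apply: leq_trans (size_vX _) _; lia.
have np : ~ power_positive K recip_mx ((n - 1) * (m - 1)).
  apply: (companion_not_positive (i0 := Ordinal n1) pos recip_pow_last); first by lia.
  by rewrite nth_default.
have n2 : (2 <= n)%N by lia.
have Kp : polyhedral_cones m K.
  apply: (generated_polyhedral_cone n2 n3 _ _ erefl companion_proper recip_mx_primitive np); lia.
split => // N; exact: (cone_exponent_gt n2 companion_proper recip_mx_primitive np).
Qed.

(** One power earlier the image is [v ^+ (n - 2) * 'X], whose constant coordinate vanishes. *)
Lemma companion_cone_first :
    (forall j, (j < m)%N -> 0 <= ('X^j %% g)`_0) ->
  polyhedral_cones m K /\
  forall N, is_cone_exponent K N -> ((n - 1) * (m - 1) <= N)%N.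
Proof.
move=> pos; have n1 : (0 < n)%N by lia.
have sv : (size (v ^+ (n - 2) * 'X)%R <= n)%N.
  apply: leq_trans (size_polyMleq _ _) _; rewrite size_polyX.
  have := size_vX (n - 2); lia.
have np : ~ power_positive K recip_mx ((n - 1) * (m - 1) - 1).
  apply: (companion_not_positive (i0 := Ordinal n1) pos recip_pow_last_pred sv).
  by rewrite coefMX.
have n2 : (2 <= n)%N by lia.
have nm1 : ((n - 1) * (m - 1) <= (n - 1) * (m - 1) - 1 + 1)%N by lia.
have Kp : polyhedral_cones m K.
  apply: (generated_polyhedral_cone n2 n3 _ nm1 erefl companion_proper recip_mx_primitive np); lia.
split => // N NK.
have := cone_exponent_gt n2 companion_proper recip_mx_primitive np NK; lia.
Qed.
End CompanionCone.

(** * Leading coefficients of powers modulo a polynomial *)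

Section TopCoefficient.
Variable F : fieldType.
Implicit Types (p q d g : {poly F}).

(* For [g] monic with roots [z_1, ..., z_n], the numbers [topmod g 'X^j] are the
   complete homogeneous symmetric polynomials of degree [j - n + 1] in the [z_i]. *)
Definition topmod g p : F := (p %% g)`_(size g).-2.

Definition topseq g k : F := topmod g 'X^k.

Lemma topmodD g p q : topmod g (p + q) = topmod g p + topmod g q.
Proof. by rewrite /topmod modpD coefD. Qed.

Lemma topmodZ g a p : topmod g (a *: p) = a * topmod g p.
Proof. by rewrite /topmod modpZl coefZ. Qed.

Lemma topmod_small g p : (size p < (size g).-1)%N -> topmod g p = 0.
Proof.
move=> pg; rewrite /topmod modp_small; last exact: leq_trans pg (leq_pred _).
by apply: nth_default; rewrite -ltnS; apply: leq_trans pg _; case: (size g) => [|[]].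
Qed.

Lemma coef_monic_mul d p k : d \is monic -> (size p <= k.+1)%N ->
  (d * p)`_((size d).-1 + k) = p`_k.
Proof.
move=> dm pk; have d0 : (0 < size d)%N by rewrite size_poly_gt0 monic_neq0.
set a := (size d).-1.
have [e se dE] : exists2 e : {poly F}, (size e <= a)%N & d = 'X^a + e.
  exists (d - 'X^a); last by rewrite addrC subrK.
  apply/leq_sizeP => j; rewrite leq_eqVlt coefB coefXn => /orP[/eqP <-|aj].
    by rewrite eqxx -/(lead_coef d) (monicP dm) subrr.
  by rewrite (gtn_eqF aj) nth_default ?subrr // -(prednK d0).
rewrite dE mulrDl coefD coefXnM ltnNge leq_addr /= addnC addnK addrC nth_default ?add0r //.
by apply: leq_trans (size_polyMleq _ _) _; lia.
Qed.

(** Dividing [d * p] by [g * d] leaves the remainder [d * (p %% g)], and multiplication by a monic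
    [d] only shifts the top coefficient. *)
Lemma topmodM g d p : g \is monic -> d \is monic -> (1 < size g)%N ->
  topmod (g * d) (d * p) = topmod g p.
Proof.
move=> gm dm g1; have g0 := monic_neq0 gm; have d0 := monic_neq0 dm.
have sd : (0 < size d)%N by rewrite size_poly_gt0.
have sr : (size (p %% g)%R < size g)%N by rewrite ltn_modp.
rewrite /topmod.
have -> : (d * p) %% (g * d) = d * (p %% g).
  apply/esym/(@modpP _ _ (p %/ g)).
    by rewrite {1}(divp_eq p g) mulrDr; congr (_ + _); ring.
  rewrite (size_mul g0 d0); apply: leq_ltn_trans (size_polyMleq _ _) _.
  by move: sr sd; move: (size (p %% g)) (size g) (size d) => x y z; lia.
rewrite (size_mul g0 d0) (_ : (size g + size d).-1.-2 = (size d).-1 + (size g).-2)%N; last first.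
  by move: g1 sd; move: (size g) (size d) => x y; lia.
rewrite coef_monic_mul //.
by move: g1 sr; move: (size (p %% g)) (size g) => x y; lia.
Qed.

Lemma topmod_mul_linear g b k : g \is monic -> (1 < size g)%N ->
  topseq (g * ('X + b%:P)) k.+1 = topseq g k - b * topseq (g * ('X + b%:P)) k.
Proof.
move=> gm g1; rewrite /topseq -[X in X - _](topmodM _ gm (monicXaddC b) g1).
by rewrite mulrDl mul_polyC topmodD topmodZ -exprS addrK.
Qed.

Definition quadratic (a b : F) : {poly F} := 'X^2 - a *: 'X + b%:P.

Lemma size_quadratic a b : size (quadratic a b) = 3%N.
Proof.
rewrite /quadratic -addrA size_polyDl ?size_polyXn //.
apply: leq_ltn_trans (size_polyD _ _) _; rewrite size_polyN size_polyC gtn_max.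
rewrite (leq_ltn_trans (size_scale_leq _ _)) ?size_polyX //=.
by case: eqP.
Qed.

Lemma quadratic_monic a b : quadratic a b \is monic.
Proof.
rewrite monicE lead_coefE size_quadratic /quadratic coefD coefB coefXn coefZ coefX coefC /=.
by rewrite mulr0 subr0 addr0.
Qed.

Lemma topmod_mul_quadratic g a b k : g \is monic -> (1 < size g)%N ->
  topseq (g * quadratic a b) k.+2 =
  a * topseq (g * quadratic a b) k.+1 - b * topseq (g * quadratic a b) k
  + topseq g k.
Proof.
move=> gm g1; rewrite /topseq -[X in _ + X](topmodM _ gm (quadratic_monic a b) g1).
have -> : quadratic a b * 'X^k = 'X^(k.+2) + (- a) *: 'X^(k.+1) + b *: 'X^k.
  by rewrite /quadratic !mulrDl -scaleNr -scalerAl mul_polyC -exprS -exprD.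
by rewrite !topmodD !topmodZ; ring.
Qed.

Fixpoint quadratic_prod (s : nat) (a b : nat -> F) : {poly F} :=
  if s is t.+1 then quadratic_prod t a b * quadratic (a t) (b t) else 'X - 1.

(** This and [shift_quadratic] solve the recurrences of [topmod_mul_linear] and
    [topmod_mul_quadratic]; the initial zeros reflect that low powers of ['X] have no top
    coefficient. *)
Definition shift_linear (b : F) (v : nat -> F) : nat -> F :=
  fix u k := if k is j.+1 then v j - b * u j else 0.

Definition shift_quadratic (a b : F) (v : nat -> F) : nat -> F :=
  fix u k := if k is (j.+1 as i).+1 then a * u i - b * u j + v j else 0.

Fixpoint quadratic_seq (s : nat) (a b : nat -> F) : nat -> F :=
  if s is t.+1 then shift_quadratic (a t) (b t) (quadratic_seq t a b) else fun=> 1.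

Lemma quadratic_seqSS s a b k : quadratic_seq s.+1 a b k.+2 =
  a s * quadratic_seq s.+1 a b k.+1 - b s * quadratic_seq s.+1 a b k + quadratic_seq s a b k.
Proof. by []. Qed.

Lemma quadratic_prod_monic s a b : quadratic_prod s a b \is monic.
Proof.
elim: s => [|s IH] /=; first exact: monicXsubC.
by rewrite monicMr ?quadratic_monic.
Qed.

Lemma size_quadratic_prod s a b : size (quadratic_prod s a b) = (2 * s + 2)%N.
Proof.
elim: s => [|s IH] /=; first exact: size_XsubC.
by rewrite size_mul ?monic_neq0 ?quadratic_monic ?quadratic_prod_monic // IH size_quadratic; lia.
Qed.

Lemma topmod_quadratic_prod s a b k :
  topseq (quadratic_prod s a b) k = quadratic_seq s a b k.
Proof.
elim: s k => [|s IH] k /=.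
  by rewrite /topseq /topmod size_XsubC modp_XsubC coefC /= hornerXn expr1n.
have gm := quadratic_prod_monic s a b.
have g1 : (1 < size (quadratic_prod s a b))%N by rewrite size_quadratic_prod; lia.
have sg := size_quadratic_prod s.+1 a b; rewrite /= in sg.
suff : topseq (quadratic_prod s a b * quadratic (a s) (b s)) k =
    shift_quadratic (a s) (b s) (quadratic_seq s a b) k /\
  topseq (quadratic_prod s a b * quadratic (a s) (b s)) k.+1 =
    shift_quadratic (a s) (b s) (quadratic_seq s a b) k.+1 by case.
elim: k => [|k [IH1 IH2]].
  by split; rewrite /topseq topmod_small // size_polyXn sg; lia.
by split=> //; rewrite topmod_mul_quadratic // IH IH1 IH2.
Qed.

Lemma topmod_quadratic_prod_linear s a b c k :
  topseq (quadratic_prod s a b * ('X + c%:P)) k =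
  shift_linear c (quadratic_seq s a b) k.
Proof.
have gm := quadratic_prod_monic s a b.
have g1 : (1 < size (quadratic_prod s a b))%N by rewrite size_quadratic_prod; lia.
elim: k => [|k IH]; last by rewrite topmod_mul_linear // IH topmod_quadratic_prod.
rewrite /topseq topmod_small // size_polyXn size_mul ?monic_neq0 ?monicXaddC //.
by rewrite size_XaddC size_quadratic_prod; lia.
Qed.
End TopCoefficient.

(** * Gaussian binomial coefficients at roots of unity *)

Section SineProducts.
Variables (R : realType) (M : nat).
Hypothesis M0 : (0 < M)%N.

Definition sinM (x : R) : R := sin (x * (pi / M%:R)).

Let Mr : 0 < M%:R :> R. Proof. by rewrite ltr0n. Qed.

Let piM_gt0 : 0 < pi / M%:R :> R. Proof. by apply: divr_gt0; rewrite ?pi_gt0. Qed.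

Lemma sinM0 : sinM 0 = 0.
Proof. by rewrite /sinM mul0r sin0. Qed.

Lemma sinM_gt0 x : 0 < x -> x < M%:R -> 0 < sinM x.
Proof.
move=> x0 xM; apply: sin_gt0_pi; rewrite mulr_gt0 //=.
by rewrite mulrA ltr_pdivrMr // mulrC ltr_pM2l ?pi_gt0.
Qed.

Lemma sinM_sub x : sinM (M%:R - x) = sinM x.
Proof.
rewrite /sinM mulrBl mulrCA mulfV ?gt_eqF // mulr1.
by rewrite addrC sinDpi sinN opprK.
Qed.

Lemma sinM_lt x y : 0 < y -> y < x -> x + y < M%:R -> sinM y < sinM x.
Proof.
move=> y0 yx xyM; rewrite -subr_gt0 /sinM.
set u := (x + y) / 2 * (pi / M%:R); set v := (x - y) / 2 * (pi / M%:R).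
have -> : x * (pi / M%:R) = u + v by rewrite /u /v -mulrDl; congr (_ * _); field.
have -> : y * (pi / M%:R) = u - v by rewrite /u /v -mulrBl; congr (_ * _); field.
have -> : sin (u + v) - sin (u - v) = 2 * (cos u * sin v) by rewrite sinD sinB; ring.
have piM := piM_gt0.
have piE : pi = M%:R * (pi / M%:R) :> R by rewrite mulrCA mulfV ?mulr1 ?gt_eqF.
rewrite mulr_gt0 // mulr_gt0 //.
  have H1 : 0 < (M%:R - (x + y)) * (pi / M%:R) by rewrite mulr_gt0 // subr_gt0.
  have H2 : 0 < (x + y) * (pi / M%:R) by rewrite mulr_gt0 // addr_gt0 // (lt_trans y0).
  apply: cos_gt0_pihalf; rewrite /u; move: piM piE H1 H2; move: (pi / _) => t.
  move: (pi : R) => p; move=> t0 pE H1 H2; apply/andP; split; lra.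
apply: sin_gt0_pi; have H1 : 0 < (M%:R - (x - y) / 2) * (pi / M%:R).
  by rewrite mulr_gt0 //; lra.
have H2 : 0 < v by rewrite mulr_gt0 //; lra.
move: piE H1 H2; rewrite /v; move: (pi / _) => t.
move: (pi : R) => p pE H1 H2.
by apply/andP; split; lra.
Qed.

(* The Gaussian binomial coefficient [x choose 2s] at [q = exp (2 i pi / M)],
   normalized to be real. *)
Fixpoint sinprod (s : nat) (x : R) : R :=
  if s is t.+1 then
    sinprod t x * (sinM (x - (2 * t)%:R) * sinM (x - (2 * t)%:R - 1)) /
    (sinM (2 * t).+1%:R * sinM (2 * t).+2%:R)
  else 1.

(** Analogue of [(x+1 choose k) (x+1-k) = (x+1) (x choose k)] for [k = 2s]. *)
Lemma sinprod_shift s x :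
  sinprod s (x + 1) * sinM (x + 1 - (2 * s)%:R) = sinM (x + 1) * sinprod s x.
Proof.
elim: s => [|s IH] /=; first by rewrite muln0 subr0 mul1r mulr1.
have -> : x + 1 - (2 * s.+1)%:R = x - (2 * s)%:R - 1.
  by rewrite mulnS natrD; ring.
have -> : x + 1 - (2 * s)%:R - 1 = x - (2 * s)%:R by ring.
rewrite !mulrA IH; ring.
Qed.

Lemma sinprod_shift2 s x : sinprod s.+1 (x + 2) =
  sinM (x + 2) * sinM (x + 1) * sinprod s x / (sinM (2 * s).+1%:R * sinM (2 * s).+2%:R).
Proof.
rewrite /= mulrA (_ : x + 2 = (x + 1) + 1); last by ring.
rewrite sinprod_shift (_ : x + 1 + 1 - (2 * s)%:R - 1 = x + 1 - (2 * s)%:R); last by ring.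
by rewrite -mulrA -mulrA (mulrA (sinprod _ _)) sinprod_shift !mulrA.
Qed.

(** This is the recurrence [quadratic_seqSS] for a pair of conjugate roots of unity. After
    [sinprod_shift] a common factor splits off and a trigonometric identity remains. *)
Lemma sinprod_rec s x :
    sinM (2 * s).+1%:R * sinM (2 * s).+2%:R != 0 ->
  sinprod s.+1 (x + 2) = 2 * cos ((2 * s).+2%:R * (pi / M%:R)) * sinprod s.+1 (x + 1)
    - sinprod s.+1 x + sinprod s x.
Proof.
set D := sinM _ * sinM _ => D0.
rewrite sinprod_shift2 /= -/D.
rewrite (_ : x + 1 - (2 * s)%:R - 1 = x - (2 * s)%:R); last by ring.
rewrite (mulrA (sinprod s (x + 1))) sinprod_shift.
set c := cos _; set S2 := sinM (x + 2); set S1 := sinM (x + 1); set S0 := sinM (x - _).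
set T := sinM (_ - 1).
suff key : S2 * S1 - 2 * c * S1 * S0 + S0 * T = D.
  have -> : S2 * S1 = D + 2 * c * S1 * S0 - S0 * T by rewrite -key; ring.
  by move: D0 {key}; move: D => d d0; field.
rewrite /S2 /S1 /S0 /T /D /c /sinM.
set t := pi / M%:R; set a := (x - (2 * s)%:R) * t; set k := (2 * s).+1%:R * t.
set r := (2 * s).+2%:R * t.
have -> : (x + 2) * t = a + r by rewrite /a /r !mulrSr; ring.
have -> : (x + 1) * t = a + k by rewrite /a /k !mulrSr; ring.
have -> : (x - (2 * s)%:R - 1) * t = a + k - r by rewrite /a /k /r !mulrSr; ring.
rewrite sinB cosD !sinD.
(* Multiplying by [cos a ^+ 2 + sin a ^+ 2 = 1] makes the identity homogeneous, so that [ring]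
   proves it. *)
have := cos2Dsin2 a => E.
have -> : sin k * sin r = (cos a ^+ 2 + sin a ^+ 2) * (sin k * sin r) by rewrite E mul1r.
ring.
Qed.

Lemma sinprod_zero s j : (j < 2 * s)%N -> sinprod s j%:R = 0.
Proof.
elim: s => [|s IH] //= js; have [js'|sj] := ltnP j (2 * s).
  by rewrite IH // !mul0r.
have [->|->] : j = (2 * s)%N \/ j = (2 * s).+1 by lia.
  by rewrite subrr sinM0 mul0r mulr0 mul0r.
by rewrite mulrSr addrAC subrr add0r subrr sinM0 !mulr0 mul0r.
Qed.

Lemma sinprod_gt0 s j : (2 * s <= j)%N -> (j < M)%N -> 0 < sinprod s j%:R.
Proof.
elim: s => [|s IH] //= js jM.
have nat_gt0 k : (0 < k)%N -> (k < M)%N -> 0 < sinM k%:R.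
  by move=> k0 kM; apply: sinM_gt0; rewrite ?ltr0n ?ltr_nat.
rewrite divr_gt0 ?mulr_gt0 ?IH ?nat_gt0 //; try lia.
  by rewrite -natrB ?nat_gt0; lia.
have -> : j%:R - (2 * s)%:R - 1 = (j - (2 * s).+1)%:R :> R.
  by rewrite natrB; [rewrite [(2 * s).+1%:R]mulrSr; ring|lia].
by apply: nat_gt0; lia.
Qed.

(** By [sinM_sub], the reflection permutes the sines in the numerator. *)
Lemma sinprod_sym s x : sinprod s (M%:R + (2 * s)%:R - 1 - x) = sinprod s x.
Proof.
elim: s x => [|s IH] x //.
rewrite (_ : _ - _ - x = (M%:R + (2 * s)%:R - 1 - x) + 2); last by rewrite mulnS natrD; ring.
rewrite sinprod_shift2 IH /=.
rewrite (_ : _ + 2 = M%:R - (x - (2 * s)%:R - 1)); last by ring.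
rewrite (_ : _ + 1 = M%:R - (x - (2 * s)%:R)); last by ring.
by rewrite !sinM_sub; congr (_ / _); ring.
Qed.

(** Argument of the [(l+1)]-st power of [exp (2 i pi / M)]; the shift skips the root 1, which
    [quadratic_prod] contains already. *)
Definition unity_angle (l : nat) : R := (2 * l).+2%:R * (pi / M%:R).

Definition cosM (l : nat) : R := 2 * cos (unity_angle l).

(** Both sides obey the recurrence [sinprod_rec] and start with two zeros. Thus the complete
    homogeneous functions of 1 and the [s] pairs of roots of unity nearest to it are Gaussian
    binomials. *)
Lemma quadratic_seq_cos s k : (2 * s < M)%N ->
  quadratic_seq s cosM (fun=> 1) k = sinprod s k%:R.
Proof.
elim: s k => [|s IH] k sM //.
have D0 : sinM (2 * s).+1%:R * sinM (2 * s).+2%:R != 0.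
  by rewrite mulf_neq0 // gt_eqF //; apply: sinM_gt0; rewrite ?ltr0n ?ltr_nat //; lia.
suff : quadratic_seq s.+1 cosM (fun=> 1) k = sinprod s.+1 k%:R /\
    quadratic_seq s.+1 cosM (fun=> 1) k.+1 = sinprod s.+1 k.+1%:R by case.
elim: k => [|k [IH1 IH2]].
  by split; rewrite sinprod_zero //; lia.
split=> //; rewrite quadratic_seqSS IH1 IH2 IH; last by lia.
rewrite (_ : k.+2%:R = k%:R + 2 :> R); last by rewrite -natrD addn2.
by rewrite sinprod_rec // mul1r -mulrSr.
Qed.

(** * Alternating sums of Gaussian binomials, for the additional root -1 *)

Section Alternating.
Variable s : nat.
Hypotheses (s0 : (0 < s)%N) (sM : (2 * s + 2 <= M)%N) (Meven : ~~ odd M).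

Let U k : R := sinprod s k%:R.
Let w := shift_linear 1 U.

Let wS k : w k.+1 = U k - w k. Proof. by rewrite /= mul1r. Qed.

Lemma sinprod_lt k : (2 * s <= k)%N -> (2 * (k + 1) < M + 2 * s)%N -> U k < U k.+1.
Proof.
move=> sk kM; have Uk : 0 < U k by apply: sinprod_gt0; lia.
have := sinprod_shift s k%:R; rewrite -mulrSr -/(U k) -/(U k.+1) -natrB; last by lia.
have lt : sinM (k.+1 - 2 * s)%:R < sinM k.+1%:R.
  by apply: sinM_lt; rewrite ?ltr0n ?ltr_nat -?natrD ?ltr_nat; lia.
have gt : 0 < sinM (k.+1 - 2 * s)%:R.
  by apply: sinM_gt0; rewrite ?ltr0n ?ltr_nat; lia.
by move=> E; rewrite -(ltr_pM2r gt) E mulrC ltr_pM2r.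
Qed.

Lemma alternating_zero k : (k <= 2 * s)%N -> w k = 0.
Proof. by elim: k => // k IH ks; rewrite wS IH ?subr0 /U ?sinprod_zero //; lia. Qed.

(** The terms [U k] increase in this range, so each alternating sum is positive and at most its last
    term. *)
Lemma alternating_half k : (2 * s <= k)%N -> (2 * k + 2 <= M + 2 * s)%N ->
  0 < w k.+1 <= U k.
Proof.
elim: k => [|k IH] sk kM; first by lia.
have [sk'|sk'] := leqP (2 * s) k.
  have /andP[w1 w2] := IH sk' ltac:(lia).
  have lt := sinprod_lt sk' ltac:(lia).
  by rewrite (wS k.+1); apply/andP; split; lra.
have w0 : w k.+1 = 0 by apply: alternating_zero; lia.
rewrite (wS k.+1) w0 subr0 lexx andbT.
by apply: sinprod_gt0; lia.
Qed.

(** [U] is symmetric about [M/2 + s - 1/2] and is the sum of two consecutive values of [w]; hence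
    [w] is symmetric about [M/2 + s]. *)
Lemma alternating_sym i : (i <= M./2 + s)%N -> w (M./2 + s + i) = w (M./2 + s - i).
Proof.
elim: i => [|i IH] iM; first by rewrite addn0 subn0.
rewrite addnS wS IH; last by lia.
rewrite (_ : M./2 + s - i = (M./2 + s - i.+1).+1)%N; last by lia.
rewrite wS; suff -> : U (M./2 + s + i) = U (M./2 + s - i.+1) by ring.
rewrite /U -[RHS]sinprod_sym; congr (sinprod s _).
have -> : M%:R = (M./2)%:R + (M./2)%:R :> R.
  by rewrite -natrD addnn -[in LHS](odd_double_half M) (negPf Meven).
have er : (M./2)%:R + s%:R = (M./2 + s - i.+1)%:R + i%:R + 1 :> R.
  by rewrite -natrD -natrD -[1]/(1%:R) -natrD; congr (_ *+ _); lia.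
have -> : (2 * s)%:R = s%:R + s%:R :> R by rewrite -natrD addnn mul2n.
have -> : (M./2 + s + i)%:R = (M./2)%:R + s%:R + i%:R :> R by rewrite !natrD.
lra.
Qed.

Lemma alternating_gt0 k : (2 * s < k)%N -> (k < M)%N -> 0 < w k.
Proof.
move=> sk kM; have M2 : M = (M./2 + M./2)%N.
  by rewrite addnn -[in LHS](odd_double_half M) (negPf Meven).
have half j : (2 * s < j)%N -> (j <= M./2 + s)%N -> 0 < w j.
  case: j => // j sj jM; have /andP[] := @alternating_half j ltac:(lia) ltac:(lia).
  by [].
have [kh|kh] := leqP k (M./2 + s); first exact: half.
rewrite (_ : k = M./2 + s + (k - (M./2 + s)))%N; last by lia.
by rewrite alternating_sym; [apply: half|]; lia.
Qed.
End Alternating.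
End SineProducts.

(** * Divisors of trinomials *)

(** The modulus of [p.[x]] is the product of the distances from [x] to the [d] roots; if all were at
    least [e], it would be at least [e ^+ d]. *)
Lemma near_root (C : numClosedFieldType) (p : {poly C}) (d : nat) (x e : C) :
    p \is monic -> size p = d.+1 -> (0 < d)%N -> 0 < e -> `|p.[x]| < e ^+ d ->
  exists2 z, root p z & `|x - z| < e.
Proof.
move=> pm sp d0 e0 px; apply: contrapT => far.
have [r pE] := closed_field_poly_normal p.
rewrite (monicP pm) scale1r in pE.
have sr : size r = d by apply/eqP; rewrite -eqSS -sp pE size_prod_XsubC.
have rp z : z \in r -> e <= `|x - z|.
  move=> zr; rewrite real_leNgt ?ger0_real ?normr_ge0 ?(ltW e0) //.
  by apply/negP => zx; apply: far; exists z; rewrite // pE root_prod_XsubC.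
suff : e ^+ d <= `|p.[x]| by move=> /le_lt_trans/(_ px); rewrite ltxx.
rewrite pE horner_prod normr_prod -sr.
elim: r rp {pE sr px far} => [|z r IH] rp; first by rewrite big_nil expr0.
rewrite big_cons exprS !hornerE ler_pM ?exprn_ge0 ?(ltW e0) ?rp ?mem_head //.
by apply: IH => y yr; rewrite rp // in_cons yr orbT.
Qed.

Section RealDivisors.
Local Open Scope complex_scope.
Variable R : realType.
Implicit Types (f : {poly R}) (x y : nat -> R).

Local Notation "p ^C" := (map_poly (real_complex R) p).

Fixpoint pair_roots (s : nat) x y : seq R[i] :=
  if s is t.+1 then (x t +i* y t) :: (x t -i* y t) :: pair_roots t x y else [:: 1].

Lemma map_quadratic (u v : R) :
  (quadratic (2 * u) (u ^+ 2 + v ^+ 2)) ^C =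
  ('X - (u +i* v)%:P) * ('X - (u -i* v)%:P).
Proof.
have -> : ('X - (u +i* v)%:P) * ('X - (u -i* v)%:P) =
    'X^2 - ((u +i* v) + (u -i* v))%:P * 'X + ((u +i* v) * (u -i* v))%:P.
  by rewrite polyCD polyCM; ring.
rewrite /quadratic rmorphD rmorphB /= map_polyXn map_polyZ map_polyX map_polyC /= -mul_polyC.
congr (_ - _%:P * _ + _%:P); apply/eqP; rewrite eq_complex /=; apply/andP; split; apply/eqP; ring.
Qed.

Lemma map_quadratic_prod s x y :
  (quadratic_prod s (fun l => 2 * x l) (fun l => x l ^+ 2 + y l ^+ 2)) ^C =
  \prod_(z <- pair_roots s x y) ('X - z%:P).
Proof.
elim: s => [|s IH] /=.
  by rewrite big_seq1 rmorphB /= map_polyX map_polyC.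
by rewrite !big_cons rmorphM /= IH map_quadratic mulrA mulrC.
Qed.

Lemma pair_rootsP s x y z : z \in pair_roots s x y ->
  z = 1 \/ exists2 l, (l < s)%N & (z = x l +i* y l \/ z = x l -i* y l).
Proof.
elim: s => [|s IH] /=; first by rewrite inE => /eqP; left.
rewrite !inE => /or3P[/eqP ->|/eqP ->|/IH[->|[l ls zE]]]; [right|right|left|right] => //.
- by exists s; rewrite ?leqnn //; left.
- by exists s; rewrite ?leqnn //; right.
- by exists l; rewrite // ltnS ltnW.
Qed.

Section Roots.
Variables (f : {poly R}) (s : nat) (x y : nat -> R).
Hypothesis f1 : f.[1] = 0.
Hypothesis y0 : forall l, (l < s)%N -> 0 < y l.
Hypothesis fxy : forall l, (l < s)%N -> root (f ^C) (x l +i* y l).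
Hypothesis xinj : forall k l, (k < l)%N -> (l < s)%N -> x k != x l.

Lemma pair_roots_root : all (root (f ^C)) (pair_roots s x y).
Proof.
apply/allP => z /pair_rootsP[->|[l ls [->|->]]].
- by rewrite rootE -(rmorph1 (real_complex R)) horner_map /= f1.
- exact: fxy.
- have := fxy ls; rewrite !rootE => /eqP fl.
  have -> : x l -i* y l = (x l +i* y l)^* by [].
  have fE : f ^C = map_poly conjc (f ^C).
    by apply/polyP => i; rewrite !coef_map /= oppr0.
  by rewrite fE -rootE complex_root_conj conjcK rootE fl.
Qed.

Lemma pair_roots_uniq : uniq (pair_roots s x y).
Proof.
have : (s <= s)%N by []; elim: {1 3}s => [|t IH] ts //=.
have yt := y0 ts.
have H (e : R) : e != 0 -> x t +i* e \notin pair_roots t x y.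
  move=> e0; apply/negP => /pair_rootsP[[_ /eqP]|[l lt [[xE _]|[xE _]]]].
  - by rewrite (negPf e0).
  - by have := xinj lt ts; rewrite xE eqxx.
  - by have := xinj lt ts; rewrite xE eqxx.
have yt0 : y t != 0 by rewrite gt_eqF.
apply/and3P; split; last by apply: IH; exact: ltnW.
  rewrite inE negb_or (H _ yt0) andbT eq_complex /= eqxx /= -subr_eq0 opprK.
  by apply: lt0r_neq0; exact: addr_gt0.
by apply: (H (- y t)); rewrite oppr_eq0.
Qed.

Let g := quadratic_prod s (fun l => 2 * x l) (fun l => x l ^+ 2 + y l ^+ 2).

(** Divisibility may be checked over the complex numbers, where [g] splits into distinct linear
    factors at roots of [f]. *)
Lemma quadratic_prod_dvd : g %| f.
Proof.
rewrite -(dvdp_map (real_complex R)) map_quadratic_prod.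
by rewrite uniq_roots_dvdp ?uniq_rootsE ?pair_roots_uniq // pair_roots_root.
Qed.

Lemma quadratic_prod_linear_dvd c : 0 < c -> f.[- c] = 0 -> g * ('X + c%:P) %| f.
Proof.
move=> c0 fc; rewrite -(dvdp_map (real_complex R)) rmorphM /= map_quadratic_prod.
have -> : ('X + c%:P) ^C = 'X - (- c)%:C%:P.
  by rewrite rmorphD /= map_polyX map_polyC /= rmorphN polyCN opprK.
have -> : \prod_(z <- pair_roots s x y) ('X - z%:P) * ('X - (- c)%:C%:P) =
    \prod_(z <- (- c)%:C :: pair_roots s x y) ('X - z%:P) by rewrite big_cons mulrC.
rewrite uniq_roots_dvdp ?uniq_rootsE //=.
  by rewrite pair_roots_root rootE horner_map /= fc eqxx.
rewrite pair_roots_uniq andbT; apply/negP => /pair_rootsP[[cE]|[l ls [[_ yE]|[_ yE]]]].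
- have : (- c) < 1 by rewrite (lt_trans _ ltr01) // oppr_lt0.
  by rewrite cE ltxx.
- by have := y0 ls; rewrite -yE ltxx.
- by have := y0 ls; rewrite -oppr_lt0 -yE ltxx.
Qed.
End Roots.

Lemma de_moivre (t : R) k : (cos t +i* sin t) ^+ k = cos (k%:R * t) +i* sin (k%:R * t).
Proof.
elim: k => [|k IH]; first by rewrite expr0 mul0r cos0 sin0.
rewrite exprSr IH mulrSr mulrDl mul1r cosD sinD.
by apply/eqP; rewrite eq_complex /= eqxx /= addrC.
Qed.

Definition unity_point (M l : nat) : R[i] :=
  let t := unity_angle R M l in cos t +i* sin t.

Lemma unity_point_pow M l : (0 < M)%N -> unity_point M l ^+ M = 1.
Proof.
move=> M0; rewrite /unity_point de_moivre /unity_angle.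
have -> : M%:R * ((2 * l).+2%:R * (pi / M%:R)) = 0 + (pi *+ 2) *+ l.+1 :> R.
  rewrite add0r -mulrnA mulrCA (mulrC M%:R) divfK ?pnatr_eq0 -?lt0n //.
  by rewrite (_ : 2 * l.+1 = (2 * l).+2)%N ?mulr_natl //; lia.
by rewrite (periodicn (@cosD2pi R)) (periodicn (@sinD2pi R)) cos0 sin0.
Qed.

Lemma unity_point_norm M l : (0 < M)%N -> `|unity_point M l| = 1.
Proof.
move=> M0; apply/eqP; rewrite -(@eqrXn2 _ M) ?normr_ge0 ?ler01 //.
by rewrite -normrX unity_point_pow // normr1 expr1n.
Qed.
End RealDivisors.

(** * Roots of the trinomials near roots of unity *)

Section Trinomial.
Local Open Scope complex_scope.
Variable R : realType.
Implicit Types (f : {poly R}) (x y : nat -> R).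
Local Notation "p ^C" := (map_poly (real_complex R) p).

Definition trinomial (m : nat) (E : R) : {poly R} :=
  'X^m + E *: 'X^(m - 1) - (1 + E)%:P.

Lemma horner_trinomial m E u :
  (trinomial m E).[u] = u ^+ m + E * u ^+ (m - 1) - (1 + E).
Proof. by rewrite /trinomial !hornerE. Qed.

Lemma map_trinomial m E (z : R[i]) :
  ((trinomial m E) ^C).[z] = z ^+ m + E%:C * z ^+ (m - 1) - (1 + E)%:C.
Proof.
rewrite /trinomial rmorphB rmorphD /= map_polyZ /= !map_polyXn map_polyC /=.
by rewrite !hornerE.
Qed.

Lemma size_trinomial m E : (1 < m)%N -> size (trinomial m E) = m.+1.
Proof.
move=> m1; rewrite /trinomial -addrA size_polyDl ?size_polyXn //.
apply: leq_ltn_trans (size_polyD _ _) _; rewrite size_polyN gtn_max.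
rewrite (leq_ltn_trans (size_scale_leq _ _)) ?size_polyXn /=; last by lia.
by rewrite (leq_ltn_trans (size_polyC_leq1 _)) //; lia.
Qed.

Lemma trinomial_monic m E : (1 < m)%N -> trinomial m E \is monic.
Proof.
move=> m1; rewrite monicE lead_coefE size_trinomial // /trinomial /= coefB coefD coefXn coefZ
  coefXn coefC.
by rewrite eqxx (gtn_eqF (_ : (m - 1 < m)%N)) ?(gtn_eqF (_ : (0 < m)%N)) ?mulr0 ?addr0 ?subr0 //;
  lia.
Qed.

Lemma near_unity_point f (M l : nat) (e : R) : f \is monic -> size f = M.+1 ->
    (0 < M)%N -> 0 < e -> `|(f ^C).[unity_point R M l]| < (e%:C) ^+ M ->
  exists xy : R * R, [/\ root (f ^C) (xy.1 +i* xy.2),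
    `|cos (unity_angle R M l) - xy.1| < e & `|sin (unity_angle R M l) - xy.2| < e].
Proof.
move=> fm sf M0 e0 small.
have fm' : f ^C \is monic by rewrite map_monic.
have sf' : size (f ^C) = M.+1 by rewrite size_map_poly.
have e0' : 0 < e%:C by rewrite ltcR.
have [[u v] rz zx] := near_root fm' sf' M0 e0' small.
exists (u, v); have : `|unity_point R M l - (u +i* v)| ^+ 2 < e%:C ^+ 2.
  by rewrite ltr_pXn2r // nnegrE ?normr_ge0 // ltW.
rewrite -add_Re2_Im2 -rmorphXn /= ltcR.
set p := cos _ - u; set q := sin _ - v => pq.
have small_abs t : t ^+ 2 < e ^+ 2 -> `|t| < e.
  by rewrite -(real_normK (num_real t)) ltr_pXn2r // ?nnegrE // ltW.
split=> //; apply: small_abs; apply: le_lt_trans pq; nra.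
Qed.

(** The flag [b] tells whether a real root [- c] near -1 is wanted as well. *)
Definition near_roots (f : {poly R}) (M s : nat) (b : bool) (e : R)
    (x y : nat -> R) (c : R) : Prop :=
  (forall l, [/\ root (f ^C) (x l +i* y l),
     `|cos (unity_angle R M l) - x l| < e & `|sin (unity_angle R M l) - y l| < e]) /\
  (b -> f.[- c] = 0 /\ `|1 - c| < e).

(** A factor [F] that is small at the [M]-th roots of unity has roots near them. [F] will be the
    trinomial itself or its cofactor once a real root is removed. *)
Lemma near_roots_intro (f F : {poly R}) (M s : nat) (b : bool) (e : R) :
    F \is monic -> size F = M.+1 -> (0 < M)%N -> 0 < e -> F %| f ->
    (forall l, `|(F ^C).[unity_point R M l]| < (e%:C) ^+ M) ->
    (b -> exists2 c, f.[- c] = 0 & `|1 - c| < e) ->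
  exists x y c, near_roots f M s b e x y c.
Proof.
move=> Fm sF M0 e0 Ff small hb.
have /choice[xy xyP] : forall l, exists xy : R * R, [/\ root (f ^C) (xy.1 +i* xy.2),
    `|cos (unity_angle R M l) - xy.1| < e & `|sin (unity_angle R M l) - xy.2| < e].
  move=> l; have [xy [rxy xe ye]] := near_unity_point Fm sF M0 e0 (small l).
  exists xy; split => //; move: rxy; rewrite -!dvdp_XsubCl => /dvdp_trans; apply.
  by rewrite dvdp_map.
have [c cP] : exists c, b -> f.[- c] = 0 /\ `|1 - c| < e.
  case: b hb => [/(_ isT)[c c1 c2]|_]; first by exists c.
  by exists 0.
by exists (fun l => (xy l).1), (fun l => (xy l).2), c; split => // l; exact: xyP.
Qed.

(** At an [m]-th root of unity [w] the trinomial equals [E (w^(m-1) - 1)], of modulus at most [2 E].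
    For [m] even it changes sign between [- (1 + E)] and -1. *)
Lemma trinomial_small_roots (m s : nat) (b : bool) (e : R) :
    (1 < m)%N -> (b -> ~~ odd m) -> 0 < e ->
  exists2 E, 0 < E & exists x y c, near_roots (trinomial m E) m s b e x y c.
Proof.
move=> m1 bm e0; have m0 : (0 < m)%N by lia.
(* The first bound makes [2 E] less than [e ^+ m]; the second keeps the real root within [e] of
   -1. *)
pose E := Num.min (e ^+ m / 3) (e / 2).
have em : 0 < e ^+ m by exact: exprn_gt0.
have E0 : 0 < E by rewrite lt_min !divr_gt0.
have E1 : E <= e ^+ m / 3 by rewrite ge_min lexx.
have E2 : E <= e / 2 by rewrite ge_min lexx orbT.
exists E => //.
apply: (@near_roots_intro _ _ m s b e (trinomial_monic E m1) (size_trinomial E m1)) => //.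
  move=> l; rewrite map_trinomial unity_point_pow //.
  have -> : 1 + E%:C * unity_point R m l ^+ (m - 1) - (1 + E)%:C = E%:C * (unity_point R m l ^+
    (m - 1) - 1).
    by rewrite rmorphD /=; ring.
  rewrite normrM ger0_norm ?lecR ?(ltW E0) // -rmorphXn /=.
  apply: (@le_lt_trans _ _ (E%:C * 2)); last first.
    by rewrite -[2](rmorph_nat (real_complex R) 2) -rmorphM ltcR; lra.
  rewrite ler_pM2l ?ltcR //; apply: le_trans (ler_normB _ _) _.
  by rewrite normrX unity_point_norm // expr1n normr1.
move=> /bm mE; have sgn u : (- u) ^+ m = u ^+ m by rewrite exprNn -signr_odd (negPf mE) expr0 mul1r.
have sgn' u : (- u) ^+ (m - 1) = - u ^+ (m - 1).
  by rewrite exprNn -signr_odd oddB // (negPf mE) expr1 mulN1r.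
have val u : (trinomial m E).[- u] = u ^+ m - E * u ^+ (m - 1) - (1 + E).
  by rewrite horner_trinomial sgn sgn'; ring.
have [||c /andP[c1 c2] rc] := @poly_ivt R (- trinomial m E) (- (1 + E)) (- 1).
- by rewrite lerN2 lerDl ltW.
- rewrite !hornerN !val !expr1n; apply/andP; split; last by lra.
  rewrite (_ : m = (m - 1).+1) ?[in _ ^+ (m - 1).+1]exprS; last by lia.
  rewrite (_ : ((m - 1).+1 - 1)%N = (m - 1)%N); last by lia.
  have : 1 + E <= (1 + E) ^+ (m - 1) by rewrite ler_eXnr //; [lia|lra].
  by nra.
exists (- c); last by rewrite ltr_norml; apply/andP; split; lra.
by move: rc; rewrite rootN opprK => /eqP.
Qed.

(* As [E] grows, one root of the trinomial escapes to [- oo] and the cofactor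
   tends to ['X^(m - 1) - 1]. *)
Lemma trinomial_large_roots (m s : nat) (e : R) : odd m -> (3 <= m)%N -> 0 < e ->
  exists2 E, 0 < E & exists x y c, near_roots (trinomial m E) (m - 1) s true e x y c.
Proof.
move=> mo m3 e0; have m1 : (1 < m)%N by lia.
have mS : m = (m - 1).+1 by lia.
have M0 : (0 < m - 1)%N by lia.
set M := (m - 1)%N in M0 mS *.
have eM : 0 < e ^+ M by exact: exprn_gt0.
(* The term [2 / e] will bring a root within [e] of -1, [4 / e ^+ M] makes the cofactor small at the
   roots of unity, and 5 leaves room for the sign checks. *)
pose E := 5 + 2 / e + 4 / e ^+ M.
have q1 : 0 < 2 / e by exact: divr_gt0.
have q2 : 0 < 4 / e ^+ M by exact: divr_gt0.
have E5 : 5 <= E by rewrite /E; lra.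
have E2 : 2 / e < E by rewrite /E; lra.
have EM : 4 / e ^+ M <= E - 5 by rewrite /E; lra.
clearbody E; have E0 : 0 < E by lra.
exists E => //.
have Me : ~~ odd M by move: mo; rewrite mS.
have sgn (u : R) : (- u) ^+ M = u ^+ M.
  by rewrite exprNn -signr_odd (negPf Me) expr0 mul1r.
have val u : (trinomial m E).[- u] = u ^+ M * (E - u) - (1 + E).
  by rewrite horner_trinomial -/M mS exprS sgn; ring.
have pow2 (u : R) : 1 <= u -> u ^+ 2 <= u ^+ M.
  by move=> u1; rewrite ler_weXn2l //; move: Me M0; case: (M) => [|[|]].
(* The escaping root: the trinomial is negative at [- E] and nonnegative at [- (E - 1)]. *)
have [||r /andP[r1 r2] fr] := @poly_ivt R (trinomial m E) (- E) (- (E - 1)).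
- by lra.
- rewrite !val subrr mulr0; apply/andP; split; first by lra.
  have := pow2 (E - 1) ltac:(lra); nra.
have /factor_theorem[F fF] := fr.
have fm := trinomial_monic E m1.
have Fm : F \is monic by move: fm; rewrite fF monicMr // monicXsubC.
have sF : size F = M.+1.
  apply: succn_inj; rewrite -mS -(size_trinomial E m1) fF size_mul ?monic_neq0 ?monicXsubC //.
  by rewrite size_XsubC addn2.
apply: (@near_roots_intro _ F _ s true e) => //; first by rewrite fF dvdp_mulr.
  move=> l; set w := unity_point R M l.
  have wM : w ^+ M = 1 by exact: unity_point_pow.
  have w1 : `|w| = 1 by exact: unity_point_norm.
  (* The trinomial takes the value [w - 1] at [w], so the cofactor has modulus at most [2 / (E - 2)]
     there. *)
  have Fw : (F ^C).[w] * (w - r%:C) = w - 1.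
    transitivity (((trinomial m E) ^C).[w]).
      by rewrite fF rmorphM rmorphB /= map_polyX map_polyC /= hornerM !hornerE.
    by rewrite map_trinomial -/M {1}mS exprSr wM rmorphD /=; ring.
  have wr : (E - 2)%:C <= `|w - r%:C|.
    have r0 : r%:C <= 0 by rewrite (lecR r 0); lra.
    have := ler_normB w (w - r%:C); rewrite subKr w1 (ler0_norm r0).
    rewrite -lerBlDl => /(le_trans _); apply.
    have -> : - r%:C - 1 = (- r - 1)%:C :> R[i] by rewrite !rmorphB /= rmorphN rmorph1.
    rewrite lecR; lra.
  have E20 : 0 < (E - 2)%:C by rewrite (ltcR 0); lra.
  rewrite -(ltr_pM2r E20); apply: (@le_lt_trans _ _ 2).
    apply: (@le_trans _ _ (`|(F ^C).[w]| * `|w - r%:C|)).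
      by rewrite ler_wpM2l ?normr_ge0.
    by rewrite -normrM Fw; apply: le_trans (ler_normB _ _) _; rewrite w1 normr1.
  rewrite -rmorphXn -rmorphM -[2](rmorph_nat (real_complex R) 2) ltcR.
  move: EM; rewrite -[4 / _ <= _](ler_pM2r eM) divfK ?gt_eqF //.
  by set t := e ^+ M in eM *; nra.
(* A root lies between [- (1 + h)] and -1: the value at -1 is -2, and bounding [(1 + h) ^+ M] below
   by [(1 + h) ^+ 2] gives at [- (1 + h)] a value with leading part [2 h E - 2 = 2]. *)
move=> _; pose h := 2 / E.
have h0 : 0 < h by exact: divr_gt0.
have hE : h * E = 2 by rewrite /h divfK // gt_eqF.
have h1 : h <= 2 / 5 by rewrite /h ler_pM2l // lef_pV2 ?posrE //; lra.
have he : h < e by rewrite /h ltr_pdivrMr //; move: E2; rewrite ltr_pdivrMr // mulrC.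
clearbody h.
have [||c /andP[c1 c2] rc] := @poly_ivt R (- trinomial m E) (- (1 + h)) (- 1).
- by lra.
- rewrite !hornerN !val expr1n; apply/andP; split; last by lra.
  have := pow2 (1 + h) ltac:(lra).
  have : 0 <= E - (1 + h) by lra.
  move: ((1 + h) ^+ M) => t u0 /(ler_wpM2r u0) tu; rewrite oppr_le0 subr_ge0.
  apply: le_trans tu; rewrite -subr_ge0.
  have -> : (1 + h) ^+ 2 * (E - (1 + h)) - (1 + E) =
    2 * (h * E) + h * (h * E) - 2 - 3 * h - 3 * h ^+ 2 - h ^+ 3 by ring.
  by rewrite hE; nra.
exists (- c); last by rewrite ltr_norml; apply/andP; split; lra.
by move: rc; rewrite rootN opprK => /eqP.
Qed.
End Trinomial.

(** * Passage to the limit *)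

Section Limits.
Variable R : realType.

Lemma cvg_quadratic_seq (s : nat) (a b : nat -> nat -> R) (A B : nat -> R) :
    (forall l, a k l @[k --> \oo] --> A l) -> (forall l, b k l @[k --> \oo] --> B l) ->
  forall j, quadratic_seq s (a k) (b k) j @[k --> \oo] --> quadratic_seq s A B j.
Proof.
move=> aA bB; elim: s => [|s IH] j; first exact: cvg_cst.
suff [] : quadratic_seq s.+1 (a k) (b k) j @[k --> \oo] --> quadratic_seq s.+1 A B j /\
  quadratic_seq s.+1 (a k) (b k) j.+1 @[k --> \oo] --> quadratic_seq s.+1 A B j.+1 by [].
elim: j => [|j [IH1 IH2]]; first by split; exact: cvg_cst.
split=> //; under eq_fun do rewrite quadratic_seqSS.
by rewrite quadratic_seqSS; apply: cvgD => //; apply: cvgB; apply: cvgM.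
Qed.

Lemma cvg_shift_linear (c : nat -> R) (C : R) (v : nat -> nat -> R) (V : nat -> R) :
    c k @[k --> \oo] --> C -> (forall j, v k j @[k --> \oo] --> V j) ->
  forall j, shift_linear (c k) (v k) j @[k --> \oo] --> shift_linear C V j.
Proof.
move=> cC vV; elim=> [|j IH] /=; first exact: cvg_cst.
by apply: cvgB => //; apply: cvgM.
Qed.

Lemma near_ord_gt0 (M : nat) (f : nat -> nat -> R) (F : nat -> R) (P : pred nat) :
    (forall j, f k j @[k --> \oo] --> F j) ->
    (forall j, P j -> (j < M)%N -> 0 < F j) ->
  \forall k \near \oo, forall j, P j -> (j < M)%N -> 0 < f k j.
Proof.
move=> fF F0.
have : \forall k \near \oo, forall j : 'I_M, P j -> 0 < f k j.
  apply: filter_forall => j; have [Pj|nPj] := boolP (P j); last by apply: nearW.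
  near=> k => _; near: k; exact: (cvgr_gt (F j) (fF j) _ (F0 j Pj (ltn_ord j))).
by apply: filterS => k H j Pj jM; exact: (H (Ordinal jM)).
Unshelve. all: by end_near. Qed.

Lemma cvg_of_dist (u : nat -> R) (l : R) :
  (forall k, `|l - u k| < k.+1%:R^-1) -> u k @[k --> \oo] --> l.
Proof.
move=> ul; apply/cvgrPdist_lt => e e0; near=> k.
by apply: lt_trans (ul k) _; near: k; exact: (near_infty_natSinv_lt (PosNum e0)).
Unshelve. all: by end_near. Qed.

Lemma quadratic_prod1 s (a b : nat -> R) : (quadratic_prod s a b).[1] = 0.
Proof.
by elim: s => [|s IH] /=; rewrite ?hornerM ?IH ?mul0r // !hornerE subrr.
Qed.

Lemma quadratic_prod_lt0 s (a b : nat -> R) : (forall l, (l < s)%N -> 0 < b l) ->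
  (quadratic_prod s a b).[0] < 0.
Proof.
elim: s => [|s IH] b0 /=; first by rewrite !hornerE oppr_lt0 ltr01.
rewrite hornerM nmulr_rlt0; last by apply: IH => l ls; apply: b0; exact: ltnW.
have -> : (quadratic (a s) (b s)).[0] = b s by rewrite /quadratic !hornerE; ring.
exact: b0.
Qed.

(* For [b = true] the divisor has an additional root near [- 1]. *)
Lemma trinomial_divisor (m M s : nat) (b : bool) :
    (forall e : R, 0 < e -> exists2 E, 0 < E &
       exists x y c, near_roots (trinomial m E) M s b e x y c) ->
    (0 < M)%N -> (2 * s < M)%N -> (b -> [/\ (0 < s)%N, (2 * s + 2 <= M)%N & ~~ odd M]) ->
  exists E (g : {poly R}), [/\ 0 < E, g \is monic, size g = (2 * s + 2 + b)%N &
    [/\ g.[1] = 0, g.[0] < 0, g %| trinomial m E &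
        forall j, (2 * s + b <= j)%N -> (j < M)%N -> 0 < topseq g j]].
Proof.
move=> approx M0 sM hb.
have /choice[d dP] : forall k, exists d : R * ((nat -> R) * (nat -> R) * R),
    0 < d.1 /\ near_roots (trinomial m d.1) M s b k.+1%:R^-1 d.2.1.1 d.2.1.2 d.2.2.
  move=> k; have [|E E0 [x [y [c H]]]] := approx k.+1%:R^-1; first by rewrite invr_gt0.
  by exists (E, ((x, y), c)).
pose E k := (d k).1; pose x k := (d k).2.1.1; pose y k := (d k).2.1.2; pose c k := (d k).2.2.
have xC l : x k l @[k --> \oo] --> cos (unity_angle R M l).
  by apply: cvg_of_dist => k; have [_ [/(_ l)[]]] := dP k.
have yC l : y k l @[k --> \oo] --> sin (unity_angle R M l).
  by apply: cvg_of_dist => k; have [_ [/(_ l)[]]] := dP k.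
have bC : b -> c k @[k --> \oo] --> (1 : R).
  by move=> bT; apply: cvg_of_dist => k; have [_ [_ /(_ bT)[]]] := dP k.
have angle0 l : (l < s)%N -> 0 < unity_angle R M l < pi.
  move=> ls; rewrite /unity_angle mulr_gt0 ?divr_gt0 ?pi_gt0 ?ltr0n //=.
  rewrite mulrCA gtr_pMr ?pi_gt0 // ltr_pdivrMr ?ltr0n // mul1r ltr_nat; lia.
have y0 : \forall k \near \oo, forall l, true -> (l < s)%N -> 0 < y k l.
  by apply: (near_ord_gt0 yC) => l _ ls; apply: sin_gt0_pi; exact: angle0.
(* The cosine is strictly decreasing on [[0, pi]], so the limits of the real parts are distinct. *)
have xinj : \forall k \near \oo, forall ij : 'I_s * 'I_s, (ij.1 < ij.2)%N -> x k ij.1 != x k ij.2.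
  apply: filter_forall => -[i j] /=; have [ij|ij] := ltnP i j; last by apply: nearW.
  have lt : 0 < cos (unity_angle R M i) - cos (unity_angle R M j).
    rewrite subr_gt0 ltr_cos ?in_itv /=.
    - by rewrite /unity_angle ltr_pM2r ?divr_gt0 ?pi_gt0 ?ltr0n // ltr_nat; lia.
    - by have /andP[/ltW -> /ltW ->] := angle0 i (ltn_ord i).
    - by have /andP[/ltW -> /ltW ->] := angle0 j (ltn_ord j).
  near=> k => _; rewrite gt_eqF // -subr_gt0; near: k.
  exact: (cvgr_gt _ (cvgB (xC i) (xC j)) _ lt).
pose a k l := 2 * x k l; pose q k l := x k l ^+ 2 + y k l ^+ 2.
have aC l : a k l @[k --> \oo] --> cosM R M l.
  by apply: cvgM; [exact: cvg_cst|exact: xC].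
have qC l : q k l @[k --> \oo] --> (fun=> 1 : R) l.
  rewrite -(cos2Dsin2 (unity_angle R M l)).
  by rewrite !expr2; apply: cvgD; apply: cvgM.
have qsC j : quadratic_seq s (a k) (q k) j @[k --> \oo] -->
    quadratic_seq s (cosM R M) (fun=> 1) j by exact: cvg_quadratic_seq.
have c0 : \forall k \near \oo, b -> 0 < c k.
  have [bT|bF] := boolP b; last by apply: nearW.
  by near=> k => _; near: k; exact: (cvgr_gt _ (bC bT) _ ltr01).
(* The limits are the sine products or their alternating sums, which are positive in this range. *)
have pos : \forall k \near \oo, forall j, (2 * s + b <= j)%N -> (j < M)%N ->
    0 < if b then shift_linear (c k) (quadratic_seq s (a k) (q k)) j
        else quadratic_seq s (a k) (q k) j.
  case: (b) hb bC => hb' bC'.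
    have [s0 sM2 Me] := hb' isT.
    apply: (near_ord_gt0 (cvg_shift_linear (bC' isT) qsC)) => j sj jM.
    have -> : shift_linear 1 (quadratic_seq s (cosM R M) (fun=> 1)) j =
        shift_linear 1 (fun k => sinprod M s k%:R : R) j.
      by congr (shift_linear _ _ _); apply/funext => k; rewrite quadratic_seq_cos.
    by apply: alternating_gt0 => //; lia.
  apply: (near_ord_gt0 qsC) => j sj jM; rewrite quadratic_seq_cos //.
  by apply: sinprod_gt0 => //; lia.
(* One index at which all these conditions hold provides [E] and the divisor. *)
have [k [yk [xk [ck posk]]]] := filter_ex (filterI y0 (filterI xinj (filterI c0 pos))).
have [Ek [rk bk]] := dP k.
have f1 : (trinomial m (E k)).[1] = 0 by rewrite horner_trinomial !expr1n mulr1 subrr.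
have y0' l : (l < s)%N -> 0 < y k l by exact: yk.
have r' l : (l < s)%N -> root (map_poly (real_complex R) (trinomial m (E k))) (Complex (x k l) (y
  k l)).
  by move=> _; have [] := rk l.
have xinj' i j : (i < j)%N -> (j < s)%N -> x k i != x k j.
  by move=> ij js; exact: (xk (Ordinal (ltn_trans ij js), Ordinal js)).
have q0 l : (l < s)%N -> 0 < q k l.
  by move=> ls; rewrite ltr_wpDl ?sqr_ge0 // exprn_gt0 // y0'.
have gm := quadratic_prod_monic s (a k) (q k).
have g1 := quadratic_prod1 s (a k) (q k).
have g0 : (quadratic_prod s (a k) (q k)).[0] < 0 by exact: quadratic_prod_lt0.
have [bT|/negPf bF] := boolP b; last first.
  exists (E k), (quadratic_prod s (a k) (q k)); split=> //.
    by rewrite size_quadratic_prod addn0.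
  split=> //; first exact: quadratic_prod_dvd.
  by move=> j sj jM; rewrite topmod_quadratic_prod; have := posk j; rewrite bF; apply.
have [fc _] := bk bT; have c0k := ck bT.
exists (E k), (quadratic_prod s (a k) (q k) * ('X + (c k)%:P)); split=> //.
- by rewrite monicMr // monicXaddC.
- by rewrite size_mul ?monic_neq0 ?monicXaddC // size_quadratic_prod size_XaddC; lia.
split.
- by rewrite hornerM g1 mul0r.
- by rewrite hornerM !hornerE nmulr_rlt0.
- exact: quadratic_prod_linear_dvd.
- by move=> j sj jM; rewrite topmod_quadratic_prod_linear; have := posk j; rewrite bT; apply.
Unshelve. all: by end_near. Qed.
End Limits.

(** * Extremal cones *)

(** With [r = p %% g] and [t] its top coefficient, the remainder of ['X * p] is
    ['X * r - t *: g]. *)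
Lemma coef0_modX (F : fieldType) (g p : {poly F}) : g \is monic -> (1 < size g)%N ->
  (('X * p) %% g)`_0 = - g`_0 * topmod g p.
Proof.
move=> gm g1; have g0 := monic_neq0 gm.
set t := topmod g p; set r := p %% g.
have sr : (size r < size g)%N by rewrite ltn_modp.
have -> : ('X * p) %% g = 'X * r - t *: g.
  apply/esym/(@modpP _ _ ('X * (p %/ g) + t%:P)).
    by rewrite {1}(divp_eq p g) -/r -mul_polyC; ring.
  rewrite -[X in (_ < X)%N](prednK (ltnW g1)) ltnS; apply/leq_sizeP => j.
  rewrite coefB coefXM coefZ leq_eqVlt => /orP[/eqP <-|gj].
    rewrite -/(lead_coef g) (monicP gm) mulr1 gtn_eqF; last by rewrite -ltnS prednK // ltnW.
    by rewrite -/r subrr.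
  rewrite (nth_default 0 (_ : (size g <= j)%N)); last by rewrite -(prednK (ltnW g1)).
  rewrite mulr0 subr0; case: j gj => // j gj /=; apply: nth_default.
  by rewrite -ltnS (leq_trans sr) // -(prednK (ltnW g1)).
by rewrite coefB coefXM /= coefZ sub0r mulNr mulrC.
Qed.

Section ExtremalCones.
Variables (R : realType) (m n : nat).
Hypotheses (n3 : (3 <= n)%N) (nm : (n <= m)%N).

(** The roots of [g] are 1, [s] conjugate pairs and, exactly when [n] is even, one near -1; the last
    is available because [m] is then even. *)
Lemma extremal_cone : ~~ odd m \/ odd n ->
  exists2 K : set 'cV[R]_n, polyhedral_cones m K &
    forall N, is_cone_exponent K N -> ((n - 1) * (m - 1) < N)%N.
Proof.
move=> par; have m0 : (0 < m)%N by lia.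
pose s := (n - 1)./2.
have nE : n = (2 * s + 1 + ~~ odd n)%N by rewrite /s; lia.
have [|||E [g [E0 gm sg [g1 _ gdvd pos]]]] :=
    @trinomial_divisor R m m s (~~ odd n) _ m0.
- move=> e e0; apply: trinomial_small_roots => //; first by lia.
  by case: par => // ->.
- by lia.
- by move=> nE'; split; [lia|lia|case: par => // no; rewrite no in nE'].
have sgn : size g = n.+1 by rewrite sg; lia.
have nneg j : (j < m)%N -> 0 <= ('X^j %% g)`_(n - 1).
  move=> jm; have := pos j; rewrite /topseq /topmod sgn /= -subn1 => posj.
  have [nj|jn] := leqP (n - 1) j; first by apply/ltW/posj; lia.
  by rewrite modp_small ?size_polyXn ?sgn ?coefXn ?gtn_eqF //; lia.
have [Kp Kg] := companion_cone_last n3 nm E0 sgn g1 gdvd nneg.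
by exists (companion_cone m g).
Qed.

(** Top coefficients are known to be positive only for powers below [m - 1]. By [coef0_modX] and
    [g.[0] < 0], the constant coefficient of [X^(j+1)] has the sign of the top coefficient of [X^j],
    so this suffices for all generators. *)
Lemma nearly_extremal_cone : odd m -> ~~ odd n ->
  exists2 K : set 'cV[R]_n, polyhedral_cones m K &
    forall N, is_cone_exponent K N -> ((n - 1) * (m - 1) <= N)%N.
Proof.
move=> mo ne; have m0 : (0 < m - 1)%N by lia.
pose s := (n - 1)./2.
have nE : n = (2 * s + 2)%N by rewrite /s; lia.
have [|||E [g [E0 gm sg [g1 g0 gdvd pos]]]] :=
    @trinomial_divisor R m (m - 1) s true _ m0.
- by move=> e e0; apply: trinomial_large_roots => //; lia.
- by lia.
- by move=> _; split; lia.
have sgn : size g = n.+1 by rewrite sg; lia.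
have nneg j : (j < m)%N -> 0 <= ('X^j %% g)`_0.
  move=> jm; have [jn|nj] := ltnP j n.
    by rewrite modp_small ?size_polyXn ?sgn ?coefXn //; lia.
  case: j jm nj => [|j] jm nj; first by lia.
  rewrite exprS coef0_modX ?sgn //; last by lia.
  rewrite mulr_ge0 //; first by rewrite oppr_ge0 -horner_coef0 ltW.
  by apply/ltW/pos; lia.
have [Kp Kg] := companion_cone_first n3 nm E0 sgn g1 gdvd nneg.
by exists (companion_cone m g).
Qed.
End ExtremalCones.

Theorem theorem7p1 (R : realType) (m n : nat) (hn : (3 <= n)%N)
    (hm : (n <= m)%N) :
  exists N : nat,
    [/\ is_max_cone_exponent R m n N,
        ~~ odd m \/ (odd m /\ odd n) -> N = ((n - 1) * (m - 1) + 1)%N &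
        odd m /\ ~~ odd n ->
          ((n - 1) * (m - 1) <= N)%N /\ (N <= (n - 1) * (m - 1) + 1)%N].
Proof.
have n2 : (2 <= n)%N by exact: ltnW.
have bound (K : set 'cV[R]_n) : polyhedral_cones m K ->
    exists2 g, is_cone_exponent K g & (g <= (n - 1) * (m - 1) + 1)%N.
  by case=> Kp Kr; exact: (cone_exponent_exists n2 Kp Kr).
(* The boolean adds 1 in the sharp case and 0 otherwise, so that one cone [K0] serves both. *)
have [K0 K0m K0N] : exists2 K : set 'cV[R]_n, polyhedral_cones m K &
    forall N, is_cone_exponent K N ->
      ((n - 1) * (m - 1) + (~~ odd m || odd n) <= N)%N.
  have [par|par] := boolP (~~ odd m || odd n).
    have [|K Km KN] := @extremal_cone R m n hn hm; first by apply/orP.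
    by exists K => // N NK; rewrite addn1; exact: KN.
  have [||K Km KN] := @nearly_extremal_cone R m n hn hm; [by lia..|].
  by exists K => // N NK; rewrite addn0; exact: KN.
(* The exponents attained form a nonempty set bounded above; its maximum is the required [N]. *)
pose Q N := `[< exists2 K : set 'cV[R]_n, polyhedral_cones m K & is_cone_exponent K N >].
have uniq_exp (K : set 'cV[R]_n) g h : is_cone_exponent K g -> is_cone_exponent K h -> (g <= h)%N.
  by move=> [[A pA Ag] _] [_ hmax]; exact: (hmax A g pA Ag).
have exQ : exists N, Q N.
  by have [g Kg _] := bound _ K0m; exists g; apply/asboolP; exists K0.
have ubQ N : Q N -> (N <= (n - 1) * (m - 1) + 1)%N.
  move=> /asboolP[K Km KN]; have [g Kg gb] := bound _ Km.
  exact: leq_trans (uniq_exp _ _ _ KN Kg) gb.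
case: (ex_maxnP exQ ubQ) => N QN maxN.
have N0 : ((n - 1) * (m - 1) + (~~ odd m || odd n) <= N)%N.
  have [g Kg _] := bound _ K0m; apply: leq_trans (K0N _ Kg) _.
  by apply: maxN; apply/asboolP; exists K0.
exists N; split.
- split; first exact/asboolP.
  move=> K Km; have [g Kg _] := bound _ Km; exists g => //.
  by apply: maxN; apply/asboolP; exists K.
- move=> par; have P : ~~ odd m || odd n by case: par => [->|[_ ->]]; rewrite ?orbT.
  by apply/eqP; rewrite eqn_leq ubQ //=; move: N0; rewrite P.
- by move=> _; split; [exact: leq_trans (leq_addr _ _) N0|exact: ubQ].
Qed.
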